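(* Let $R$ be a ring and $\mathcal D$ a deconstructible class of right $R$-modules. Then either there is a cardinal $\theta$ such that $\mathcal D$ is not $\lambda$-categorical for any cardinal $\lambda>\theta$, or there is a cardinal $\theta'$ such that $\mathcal D$ is $\lambda$-categorical for every cardinal $\lambda\geq\theta'$. In other words, categoricity of $\mathcal D$ in a sufficiently big cardinal is equivalent to its categoricity in a tail of cardinals.
   Context: For a class $\mathcal C$ of modules, a $\mathcal C$-filtration of a module $M$ is an increasing chain of submodules $(M_\alpha\mid\alpha<\sigma)$ with $M_0=0$, $M=\bigcup_{\alpha<\sigma}M_\alpha$, $M_\alpha=\bigcup_{\beta<\alpha}M_\beta$ for limit $\alpha$, and each $M_{\alpha+1}/M_\alpha$ isomorphic to a member of $\mathcal C$; $\mathrm{Filt}(\mathcal C)$ is the class of modules possessing a $\mathcal C$-filtration. A class $\mathcal D$ is $\kappa$-deconstructible ($\kappa$ infinite cardinal) if there is a subset $\mathcal C\subseteq\mathcal D$ consisting of $<\kappa$-presented modules with $\mathcal D=\mathrm{Filt}(\mathcal C)$; deconstructible means $\kappa$-deconstructible for some $\kappa$. $\mathcal D$ is $\lambda$-categorical if it contains a module of cardinality $\lambda$ and all its modules of cardinality $\lambda$ are isomorphic. *)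

(* Defs.v *)
From HB Require Import structures.
From mathcomp Require Import all_boot all_algebra.
From mathcomp Require Import boolp classical_sets functions cardinality wochoice.

Set Implicit Arguments.
Unset Strict Implicit.
Unset Printing Implicit Defensive.

Import GRing.Theory.
Local Open Scope ring_scope.
Local Open Scope classical_set_scope.
Local Open Scope card_scope.

(* Cardinals are represented by types, compared through injections and
   bijections. [free_module] and [carrier] below identify the universe of
   [cardinal] with the universe of the carriers of modules, so every module has
   a cardinality and every cardinal can be the size of a module. Sets (index
   sets, ordinals) are the types of that universe; classes of modules are
   arbitrary predicates on modules. *)
Definition cardinal := Type.

Definition cardinal_le (k l : cardinal) : Prop := [set: k] #<= [set: l].

Definition cardinal_eq (k l : cardinal) : Prop := [set: k] #= [set: l].

Definition cardinal_lt (k l : cardinal) : Prop :=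
  cardinal_le k l /\ ~ cardinal_eq k l.

Definition cardinal_infinite (k : cardinal) : Prop := infinite_set [set: k].

(* A right R-module is a left module over the converse ring. *)
Notation rmodType R := (lmodType R^c).

Definition carrier (R : pzRingType) (M : lmodType R) : cardinal := M.

Definition isomorphic (R : pzRingType) (M N : lmodType R) : Prop :=
  exists f : {linear M -> N}, bijective f.

Section Submodule.
Variables (R : pzRingType) (V : lmodType R) (A : submodClosed V).

Record submodule : Type := Submodule {
  submodule_val : V;
  submodule_valP : submodule_val \in A
}.

HB.instance Definition _ := [isSub for submodule_val].
HB.instance Definition _ := [Choice of submodule by <:].
HB.instance Definition _ := [SubChoice_isSubLmodule of submodule by <:].

End Submodule.

Section QuotientModule.
Variables (R : pzRingType) (V : lmodType R) (A : submodClosed V).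

(* [Quotient.quot] wants a subset declared closed under opposite, which
   [submodClosed] does not provide, hence this copy of A. *)
Definition submod_pred : {pred V} := [pred v | v \in A].

Fact submod_pred_zmod_closed : zmod_closed submod_pred.
Proof.
have [A0 AB] : zmod_closed A.
  by apply: GRing.submod_closedB; apply: GRing.submodClosedP.
by split=> [|x y]; rewrite !inE //; apply: AB.
Qed.

HB.instance Definition _ :=
  GRing.isZmodClosed.Build V submod_pred submod_pred_zmod_closed.

Definition quotient_module : Type := Quotient.quot submod_pred.

HB.instance Definition _ := GRing.Zmodule.on quotient_module.
HB.instance Definition _ := EqQuotient.on quotient_module.

Local Notation pi := (\pi_(quotient_module)%qT).

Definition quotient_scale (a : R) (x : quotient_module) : quotient_module :=
  pi (a *: repr x).

Fact quotient_eqP x y : (pi x = pi y) <-> x - y \in A.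
Proof.
have := @Quotient.idealrBE V submod_pred x y; rewrite inE => ->.
by split=> /eqP.
Qed.

Fact quotient_scale_pi a v : quotient_scale a (pi v) = pi (a *: v).
Proof.
apply/quotient_eqP; rewrite -scalerBr rpredZ //.
by apply/quotient_eqP; rewrite reprK.
Qed.

Fact quotient_piD x y : pi (x + y) = pi x + pi y.
Proof. exact: (@Quotient.pi_add V submod_pred x y). Qed.

Fact quotient_scaleA a b x :
  quotient_scale a (quotient_scale b x) = quotient_scale (a * b) x.
Proof.
elim/quotW: x => v; rewrite [quotient_scale b _]quotient_scale_pi.
by rewrite [LHS]quotient_scale_pi [RHS]quotient_scale_pi scalerA.
Qed.

Fact quotient_scale1 : left_id 1 quotient_scale.
Proof. by elim/quotW=> v; rewrite quotient_scale_pi scale1r. Qed.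

Fact quotient_scaleDr : right_distributive quotient_scale +%R.
Proof.
move=> a; elim/quotW=> v; elim/quotW=> w.
by rewrite -quotient_piD [LHS]quotient_scale_pi scalerDr quotient_piD
           -!quotient_scale_pi.
Qed.

Fact quotient_scaleDl x : {morph quotient_scale^~ x : a b / a + b}.
Proof.
move=> a b; elim/quotW: x => v.
by rewrite [LHS]quotient_scale_pi scalerDl quotient_piD -!quotient_scale_pi.
Qed.

HB.instance Definition _ := GRing.Zmodule_isLmodule.Build R quotient_module
  quotient_scaleA quotient_scale1 quotient_scaleDr quotient_scaleDl.

End QuotientModule.

Section Subquotient.
Variables (R : pzRingType) (V : lmodType R) (A B : submodClosed V).

Definition submod_trace : {pred submodule B} :=
  [pred x | submodule_val x \in A].

Fact submod_trace_closed : submod_closed submod_trace.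
Proof.
split=> [|a x y]; rewrite !inE; first exact: (rpred0 A).
by move=> xA yA; rewrite /= rpredD // rpredZ.
Qed.

HB.instance Definition _ :=
  GRing.isSubmodClosed.Build R (submodule B) submod_trace submod_trace_closed.

(* The quotient B / A, for A included in B. *)
Definition subquotient : lmodType R := quotient_module submod_trace.

End Subquotient.

Section FreeModule.
Variables (R : pzRingType) (X : cardinal).

Definition finsupp_pred : {pred X -> R^o} :=
  [pred f : X -> R^o | `[< finite_set [set x | f x <> 0] >]].

Fact finsupp_pred_closed : submod_closed finsupp_pred.
Proof.
split=> [|a f g].
  by apply/asboolP; rewrite (_ : mkset _ = set0) // -subset0 => x /=.
rewrite ![_ \in _]/= => /asboolP ff /asboolP fg; apply/asboolP.
have : finite_set ([set x | f x <> 0] `|` [set x | g x <> 0]).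
  by rewrite finite_setU.
apply: sub_finite_set => x /= fgx.
have [fx0|fx0] := pselect (f x = 0); last by left.
by right=> gx0; apply: fgx; rewrite fctE /= !fctE fx0 gx0 scaler0 addr0.
Qed.

HB.instance Definition _ :=
  GRing.isSubmodClosed.Build R (X -> R^o) finsupp_pred finsupp_pred_closed.

(* R^(X), the finitely supported functions from X to R. *)
Definition free_module : lmodType R := submodule finsupp_pred.

End FreeModule.

Section Classes.
Variable R : pzRingType.
Implicit Types (M N : lmodType R) (C D : lmodType R -> Prop).

Definition generates M (G : set M) (K : submodClosed M) : Prop :=
  (forall g, G g -> g \in K) /\
  (forall L : submodClosed M,
     (forall g, G g -> g \in L) -> {subset K <= L}).

(* M has a presentation with fewer than k generators and fewer than k
   relations. *)
Definition lt_presented (k : cardinal) M : Prop :=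
  exists (X : cardinal) (K : submodClosed (free_module R X))
         (G : set (free_module R X)),
    [/\ cardinal_lt X k, cardinal_lt (set_type G) k, generates G K
      & isomorphic (quotient_module K) M].

Section WellOrder.
Variables (S : cardinal) (le : rel S).

Definition slt (a b : S) : Prop := le a b /\ a <> b.

Definition is_zero (a : S) : Prop := forall b, ~ slt b a.

Definition is_succ (a b : S) : Prop :=
  slt a b /\ forall c, ~ (slt a c /\ slt c b).

Definition is_limit (a : S) : Prop :=
  ~ is_zero a /\ forall b, ~ is_succ b a.

End WellOrder.

(* The ordinal indexing the chain is given by a well-ordered type (S, le). *)
Definition is_filtration C M (S : cardinal) (le : rel S)
    (F : S -> submodClosed M) : Prop :=
  [/\ forall a b, le a b -> {subset F a <= F b},
      forall a, is_zero le a -> forall x, x \in F a <-> x = 0,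
      forall x, exists a, x \in F a,
      forall a, is_limit le a ->
        forall x, x \in F a <-> exists2 b, slt le b a & x \in F b
    & forall a b, is_succ le a b ->
        exists2 N, C N & isomorphic (subquotient (F a) (F b)) N].

Definition Filt C M : Prop :=
  exists (S : cardinal) (le : rel S) (F : S -> submodClosed M),
    well_order le /\ is_filtration C le F.

(* A set of modules, as opposed to a class, is the range of a family indexed by
   a type of the universe of cardinals. *)
Definition range_class (I : cardinal) (c : I -> lmodType R) :
    lmodType R -> Prop :=
  fun N => exists i, N = c i.

Definition deconstructible_at (k : cardinal) D : Prop :=
  cardinal_infinite k /\
  exists (I : cardinal) (c : I -> lmodType R),
    [/\ forall i, D (c i), forall i, lt_presented k (c i)
      & forall M, D M <-> Filt (range_class c) M].

Definition deconstructible D : Prop := exists k, deconstructible_at k D.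

Definition categorical (l : cardinal) D : Prop :=
  (exists2 M, D M & cardinal_eq (carrier M) l) /\
  (forall M N, D M -> D N -> cardinal_eq (carrier M) l ->
     cardinal_eq (carrier N) l -> isomorphic M N).

End Classes.

(* Main.v *)
(* Write D = Filt(C) and let K0 be an infinite cardinal bounding R and the members
   of C. If D is categorical in arbitrarily large cardinals, fix such a K > K0
   and P in D of size K. Let M in D have size mu > K, and let D be categorical
   in some l > mu. Then M (+) P^(l) and P^(l) have size l and lie in D, so they
   are isomorphic and M is a direct summand of P^(l). Closing off
   simultaneously under Hill's lemma (for a filtration of M) and Kaplansky's
   argument (for the summand) writes M as a direct sum, over a set S of size
   mu, of nonzero members of D of size at most K. As mu * K = mu, these can be
   grouped K at a time; each group lies in D and has size K, hence is a copy of
   P, and M is isomorphic to P^(mu). *)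

Require Import Defs.
From HB Require Import structures.
From mathcomp Require Import finmap all_boot all_algebra.
From mathcomp Require Import boolp classical_sets functions cardinality wochoice.

Set Implicit Arguments.
Unset Strict Implicit.
Unset Printing Implicit Defensive.

Import GRing.Theory.
Local Open Scope ring_scope.
Local Open Scope classical_set_scope.

(** * Cardinal arithmetic *)

Lemma cardinal_leP (K L : Type) :
  cardinal_le K L <-> exists f : K -> L, injective f.
Proof.
split=> [/card_leP[f]|[f finj]].
  exists (fun k => val (f (exist _ k (mem_set I)))) => x y /val_inj.
  have fI := @inj _ _ [set: [set: K]] f.
  by move=> /(fI _ _ (mem_set I) (mem_set I)) [].
apply/card_leP/injfunPex.
exists (fun k : [set: K] => exist _ (f (val k)) (mem_set I)) => // x y _ _.
by move=> /(congr1 val) /finj /val_inj.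
Qed.

Lemma cardinal_eqP (K L : Type) :
  cardinal_eq K L <-> exists f : K -> L, bijective f.
Proof.
split=> [/card_bijP[f [g fK gK]]|[f [g fK gK]]].
  exists (fun k => val (f (exist _ k (mem_set I)))).
  exists (fun k => val (g (exist _ k (mem_set I)))) => x.
    rewrite (_ : exist _ _ _ = f (exist _ x (mem_set I))) ?fK //.
    exact: val_inj.
  rewrite (_ : exist _ _ _ = g (exist _ x (mem_set I))) ?gK //.
  exact: val_inj.
apply/card_bijP.
exists (fun k => exist _ (f (val k)) (mem_set I)).
exists (fun k => exist _ (g (val k)) (mem_set I)) => x; apply: val_inj;
  [exact: fK|exact: gK].
Qed.

Lemma cardinal_le_refl K : cardinal_le K K.
Proof. by apply/cardinal_leP; exists id. Qed.

Lemma cardinal_le_trans (L K N : Type) :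
  cardinal_le K L -> cardinal_le L N -> cardinal_le K N.
Proof. exact: card_le_trans. Qed.

Lemma cardinal_le_anti K L : cardinal_le K L -> cardinal_le L K -> cardinal_eq K L.
Proof. by move=> KL LK; rewrite /cardinal_eq card_eq_le; apply/andP. Qed.

Lemma cardinal_eqW K L : cardinal_eq K L -> cardinal_le K L.
Proof. by rewrite /cardinal_eq card_eq_le => /andP[]. Qed.

Lemma cardinal_eq_sym K L : cardinal_eq K L -> cardinal_eq L K.
Proof. exact: card_esym. Qed.

Lemma cardinal_eq_trans (L K N : Type) :
  cardinal_eq K L -> cardinal_eq L N -> cardinal_eq K N.
Proof. exact: card_eq_trans. Qed.

Lemma cardinal_le_total K L : cardinal_le K L \/ cardinal_le L K.
Proof.
pose P (A : set (K * L)) := forall p q, A p -> A q -> (p.1 = q.1 <-> p.2 = q.2).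
have [|A [PA Amax]] := @Zorn_bigcup _ P.
  move=> F FP Ftot p q [X FX Xp] [Y FY Yq].
  by have [XY|YX] := Ftot _ _ FX FY; [apply: (FP _ FY)|apply: (FP _ FX)] => //;
    [apply: XY|apply: YX].
have [Adom|/existsNP[k Ak]] := pselect (forall k, exists l, A (k, l)).
  left; apply/cardinal_leP; have [f Af] := choice Adom.
  by exists f => x y fxy; apply/(PA (x, f x) (y, f y)).
have [Arng|/existsNP[l Al]] := pselect (forall l, exists k, A (k, l)).
  right; apply/cardinal_leP; have [f Af] := choice Arng.
  by exists f => x y fxy; apply/(PA (f x, x) (f y, y)).
exfalso; apply: (Amax (A `|` [set (k, l)])).
  split; first exact: subsetUl.
  by move=> /(_ (k, l) (or_intror erefl)) Akl; apply: Ak; exists l.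
move=> [k1 l1] [k2 l2] [A1|[-> ->]] [A2|[-> ->]] //=; first exact: PA A1 A2.
- by split=> E; exfalso; [apply: Ak; exists l1; rewrite -E
                        |apply: Al; exists k1; rewrite -E].
- by split=> E; exfalso; [apply: Ak; exists l2; rewrite E
                        |apply: Al; exists k2; rewrite E].
Qed.

Lemma infinite_sub_injection T (D : set T) :
  infinite_set D -> exists f : nat -> T, injective f /\ forall i, D (f i).
Proof.
move=> /infiniteP DN.
have /cardinal_leP[f finj] : cardinal_le nat D.
  by rewrite /cardinal_le (card_le_eqr (card_setT D)).
exists (fun i => val (f i)); split=> [i j /val_inj/finj //|i].
exact: set_mem (valP (f i)).
Qed.

Lemma set_injection_total T (A B : set T) :
  cardinal_le A B -> B !=set0 ->
  exists f : T -> T, (forall x, A x -> B (f x)) /\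
    (forall x y, A x -> A y -> f x = f y -> x = y).
Proof.
move=> /cardinal_leP[f finj] [b Bb].
exists (fun x => if pselect (A x) is left Ax then val (f (exist _ x (mem_set Ax))) else b).
split=> [x Ax|x y Ax Ay]; case: pselect => // Ax'.
  exact: set_mem (valP (f _)).
by case: pselect => // Ay' /val_inj/finj [].
Qed.

(* A [pairing D A] is the graph of an injective relation from [D * D] to [D];
   functionality would be preserved along the way but is not needed. *)
Definition pairing X (D : set X) (A : set (X * X * X)) :=
  [/\ forall x y, D x -> D y -> exists z, A (x, y, z),
     forall x y z, A (x, y, z) -> [/\ D x, D y & D z]
   & forall p q, A p -> A q -> p.2 = q.2 -> p.1 = q.1].

Lemma pairing_fun X (D : set X) A : pairing D A ->
  exists p : X -> X -> X, (forall x y, D x -> D y -> D (p x y)) /\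
    forall x y x' y', D x -> D y -> D x' -> D y' -> p x y = p x' y' ->
      x = x' /\ y = y'.
Proof.
move=> [Atot Aval Ainj].
have /choice[p pP] : forall xy : X * X, exists z, D xy.1 -> D xy.2 -> A (xy, z).
  move=> [x y] /=; have [Dx|Dx] := pselect (D x); last by exists x.
  have [Dy|Dy] := pselect (D y); last by exists x.
  by have [z] := Atot x y Dx Dy; exists z.
exists (fun x y => p (x, y)); split=> [x y Dx Dy|x y x' y' Dx Dy Dx' Dy' pE].
  by have [] := Aval _ _ _ (pP (x, y) Dx Dy).
by have [-> ->] := Ainj _ _ (pP (x, y) Dx Dy) (pP (x', y') Dx' Dy') pE.
Qed.

Lemma cardinal_square (X : Type) :
  cardinal_infinite X -> cardinal_le (X * X)%type X.
Proof.
move=> /infinite_sub_injection[n [ninj _]].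
pose P A := A = set0 \/ exists2 D : set X, infinite_set D & pairing D A.
have [|A [PA Amax]] := @Zorn_bigcup _ P.
  move=> F FP Ftot; have [F0|/existsNP[A0]] := pselect (forall A, F A -> A = set0).
    by left; rewrite bigcup0.
  move=> /not_implyP[FA0 A0N]; right; case: (FP _ FA0) => [//|[D0 D0inf pA0]].
  exists [set x | exists2 A, F A & exists z, A (x, x, z)].
    apply: contra_not D0inf; apply: sub_finite_set => x D0x; exists A0 => //.
    by have [/(_ x x D0x D0x)] := pA0.
  have pF A a : F A -> A a -> exists D, pairing D A.
    by move=> FA Aa; case: (FP _ FA) Aa => [->//|[D _ ?]]; exists D.
  split=> [x y [A FA [z Az]] [B FB [t Bt]]|x y z [A FA /= Az]|p q [A FA Ap] [B FB Bq]].
  - wlog AB : x y A B FA FB z Az t Bt / A `<=` B.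
      move=> wl; have [AB|BA] := Ftot _ _ FA FB; first exact: wl Az _ Bt AB.
      have [D [Dt Dv _]] := pF _ _ FA Az.
      have [Dx _ _] := Dv _ _ _ Az; have [Dy _ _] := Dv _ _ _ (BA _ Bt).
      by have [u Au] := Dt _ _ Dx Dy; exists u; exists A.
    have [D [Dt Dv _]] := pF _ _ FB Bt.
    have [Dx _ _] := Dv _ _ _ (AB _ Az); have [Dy _ _] := Dv _ _ _ Bt.
    by have [u Bu] := Dt _ _ Dx Dy; exists u; exists B.
  - have [D [Dt Dv _]] := pF _ _ FA Az; have [Dx Dy Dz] := Dv _ _ _ Az.
    by split; exists A => //; exact: Dt.
  - by have [AB|BA] := Ftot _ _ FA FB; [have [D [_ _ I]] := pF _ _ FB Bq
      |have [D [_ _ I]] := pF _ _ FA Ap]; apply: I => //; [apply: AB|apply: BA].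
case: PA => [A0|[D Dinf pA]].
  exfalso; pose B := [set t : X * X * X | exists i j, t = (n i, n j, n (pickle (i, j)))].
  apply: (Amax B).
    rewrite A0; split=> [//|]; move=> /(_ (n 0%N, n 0%N, n (pickle (0, 0)%N))).
    by apply; exists 0%N, 0%N.
  right; exists (range n).
    apply/infiniteP/card_leP/injfunPex.
    exists (fun i : [set: nat] => exist _ (n (val i)) (mem_set (imageP n I))) => //.
    by move=> i j _ _ /(congr1 val)/ninj/val_inj.
  split.
  - by move=> _ _ [i _ <-] [j _ <-]; exists (n (pickle (i, j))), i, j.
  - by move=> x y z [i [j [-> -> ->]]]; split; [exists i|exists j|exists (pickle (i, j))].
  - move=> _ _ [i [j ->]] [k [l ->]] /= /ninj/(pcan_inj pickleK)[-> ->] //.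
have [p [pD pinj]] := pairing_fun pA.
have [d [dinj dD]] := infinite_sub_injection Dinf.
have d01 : d 0%N <> d 1%N by move=> /dinj.
have code C k : (forall x, C x -> ~ D x) -> (forall x, C x -> D (k x)) ->
    (forall x y, C x -> C y -> k x = k y -> x = y) ->
    exists h : X -> X, (forall x, (D `|` C) x -> D (h x)) /\
      forall x y, (D `|` C) x -> (D `|` C) y -> h x = h y -> x = y.
  move=> CD kD kinj.
  exists (fun x => if pselect (D x) then p x (d 0%N) else p (k x) (d 1%N)).
  split=> [x [Dx|Cx]|x y DCx DCy].
  - by case: pselect => // ?; apply: pD.
  - by case: pselect => [/(CD _ Cx)//|?]; apply: pD => //; apply: kD.
  - case: pselect => Dx; case: pselect => Dy /pinj.
    + by case=> //.
    + by case: DCy => // Cy [] //; apply: kD.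
    + by case: DCx => // Cx [] //; [apply: kD|move=> _ /esym].
    + case: DCx => // Cx; case: DCy => // Cy [] //; try exact: kD.
      by move=> kE _; apply: kinj.
have DC : D `|` ~` D = setT by rewrite setUv.
have [DleC|CleD] := cardinal_le_total D (~` D); last first.
  have [k [kD kinj]] : exists k : X -> X, (forall x, (~` D) x -> D (k x)) /\
      (forall x y, (~` D) x -> (~` D) y -> k x = k y -> x = y).
    by apply: set_injection_total => //; exists (d 0%N).
  have [h [hD hinj]] := code (~` D) k (fun _ => id) kD kinj.
  rewrite DC in hD hinj; apply/cardinal_leP; exists (fun xy => p (h xy.1) (h xy.2)).
  by move=> [x y] [x' y'] /= /pinj[]; try exact: hD; move=> /hinj -> // /hinj ->.
exfalso.
have [g [gC ginj]] : exists g : X -> X, (forall x, D x -> (~` D) (g x)) /\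
    (forall x y, D x -> D y -> g x = g y -> x = y).
  apply: set_injection_total => //; have /cardinal_leP[g _] := DleC.
  by exists (val (g (exist _ (d 0%N) (mem_set (dD _))))); apply: set_mem (valP (g _)).
pose E := g @` D.
have /choice[k kP] : forall y, exists x, E y -> D x /\ g x = y.
  move=> y; have [[x Dx <-]|Ey] := pselect (E y); last by exists y.
  by exists x.
have ED x : E x -> ~ D x by move=> [y Dy <-]; apply: gC.
have [h [hD hinj]] : exists h : X -> X, (forall x, (D `|` E) x -> D (h x)) /\
      forall x y, (D `|` E) x -> (D `|` E) y -> h x = h y -> x = y.
  apply: (code E k) => // [x /kP[]//|x y /kP[_ gx] /kP[_ gy] kxy].
  by rewrite -gx -gy kxy.
pose B := [set t : X * X * X | [/\ (D `|` E) t.1.1, (D `|` E) t.1.2,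
  ~ (D t.1.1 /\ D t.1.2) & t.2 = g (p (h t.1.1) (h t.1.2))]].
have [Atot Aval Ainj] := pA.
apply: (Amax (A `|` B)).
  split=> [|BA]; first exact: subsetUl.
  have Eg : E (g (d 0%N)) by exists (d 0%N).
  have [] := Aval (g (d 0%N)) (g (d 0%N)) (g (p (h (g (d 0%N))) (h (g (d 0%N))))).
    by apply: BA; right; split=> //=; [right|right|case=> /(ED _ Eg)].
  by move=> /(ED _ Eg).
right; exists (D `|` E); first by apply: contra_not Dinf; apply: sub_finite_set; left.
split=> [x y Dx Dy|x y z [/Aval[Dx Dy Dz]|[/= Dx Dy _ ->]]|].
- have [[DDx DDy]|NDD] := pselect (D x /\ D y).
    by have [z Az] := Atot _ _ DDx DDy; exists z; left.
  by exists (g (p (h x) (h y))); right.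
- by split; left.
- by split=> //; right; exists (p (h x) (h y)) => //; apply: pD; apply: hD.
move=> [[x y] z] [[x' y'] z'] /= [Ap|[/= Dx Dy _ zE]] [Aq|[/= Dx' Dy' _ zE']] zz.
- exact: Ainj Ap Aq zz.
- have [_ _ Dz] := Aval _ _ _ Ap; exfalso; move: Dz; rewrite zz zE'.
  by apply: gC; apply: pD; apply: hD.
- have [_ _ Dz] := Aval _ _ _ Aq; exfalso; move: Dz; rewrite -zz zE.
  by apply: gC; apply: pD; apply: hD.
- have pDE u v : (D `|` E) u -> (D `|` E) v -> D (p (h u) (h v)).
    by move=> /hD hu /hD; apply: pD.
  move: zz; rewrite zE zE' => /(ginj _ _ (pDE _ _ Dx Dy) (pDE _ _ Dx' Dy')).
  by move=> /pinj[]; try exact: hD; move=> /hinj -> // /hinj ->.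
Qed.

Lemma cardinal_le_infinite K L :
  cardinal_le K L -> cardinal_infinite K -> cardinal_infinite L.
Proof. by move=> KL Kinf Lfin; apply: Kinf; apply: card_le_finite KL Lfin. Qed.

Lemma cardinal_le_nat X : cardinal_infinite X -> cardinal_le nat X.
Proof. by move/infiniteP. Qed.

Lemma cardinal_seq X : cardinal_infinite X -> cardinal_le (seq X) X.
Proof.
move=> Xinf; have /cardinal_leP[p pinj] := cardinal_square Xinf.
have /cardinal_leP[n ninj] := cardinal_le_nat Xinf.
apply/cardinal_leP; exists (fun s => p (n (size s), foldr (fun x y => p (x, y)) (n 0%N) s)).
elim=> [|x s IH] [|y t] //= /pinj[/ninj// [st] /pinj[-> E]].
by congr cons; apply: IH; rewrite st E.
Qed.

(* [A #<= [set: K]], through a partial surjection rather than an injection. *)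
Definition small (K : Type) T (A : set T) := exists r : K -> T -> Prop,
  (forall k x y, r k x -> r k y -> x = y) /\ forall x, A x -> exists k, r k x.

Lemma small_cardinal K T : small K [set: T] <-> cardinal_le T K.
Proof.
split=> [[r [rfun /(_ _ I)]]|/cardinal_leP[f finj]].
  move=> /choice[f fP]; apply/cardinal_leP; exists f => x y fE.
  by apply: (rfun (f x)); rewrite // fE.
by exists (fun k x => f x = k); split=> [k x y <- /finj//|x _]; exists (f x).
Qed.

Lemma small_le L K T (A : set T) : cardinal_le L K -> small L A -> small K A.
Proof.
move=> /cardinal_leP[f finj] [r [rfun rA]].
exists (fun k x => exists2 l, f l = k & r l x); split=> [k x y [l <- lx] [m]|x].
  by move=> /finj -> /(rfun _ _ _ lx).
by move=> /rA[l lx]; exists (f l), l.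
Qed.

Lemma small_sub K T (A B : set T) : A `<=` B -> small K B -> small K A.
Proof. by move=> AB [r [rfun rB]]; exists r; split=> // x /AB/rB. Qed.

Lemma small_rel_image K T U (r : T -> U -> Prop) (A : set T) (B : set U) :
  (forall x y z, r x y -> r x z -> y = z) ->
  (forall y, B y -> exists2 x, A x & r x y) -> small K A -> small K B.
Proof.
move=> rfun rB [s [sfun sA]]; exists (fun k y => exists2 x, s k x & r x y); split.
  by move=> k y z [x /sfun sx xy] [x' /sx <-]; apply: rfun.
by move=> y /rB[x /sA[k kx] xy]; exists k, x.
Qed.

Lemma small_image K T U (f : T -> U) (A : set T) : small K A -> small K (f @` A).
Proof.
by apply: (@small_rel_image _ _ _ (fun x y => f x = y)) => [x y z <- <-|y [x]] //; exists x.
Qed.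

Lemma small_bigcup K T U (A : set T) (B : T -> set U) : cardinal_infinite K ->
  small K A -> (forall x, A x -> small K (B x)) -> small K (\bigcup_(x in A) B x).
Proof.
move=> Kinf [s [sfun sA]] /= Bs; apply: small_le (cardinal_square Kinf) _.
have /choice[r rP] x : exists r : K -> U -> Prop, A x ->
    (forall k y z, r k y -> r k z -> y = z) /\ forall y, B x y -> exists k, r k y.
  have [Ax|NAx] := pselect (A x); last by exists (fun _ _ => False).
  by have [r rP] := Bs x Ax; exists r.
exists (fun kl y => exists2 x, A x & s kl.1 x /\ r x kl.2 y); split.
  move=> [k l] y z [x Ax [/= /sfun sx xy]] [x' _ [/= /sx <- xz]].
  by have [rfun _] := rP x Ax; apply: rfun xy xz.
move=> y [x Ax Bxy]; have [k kx] := sA x Ax; have [_ /(_ y Bxy)[l ly]] := rP x Ax.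
by exists (k, l), x.
Qed.

Lemma finite_small K T (A : set T) : cardinal_infinite K -> finite_set A -> small K A.
Proof.
move=> Kinf /finite_setP[n]; rewrite card_eq_le => /andP[An _].
have : cardinal_le A K.
  apply: cardinal_le_trans (cardinal_le_nat Kinf).
  rewrite /cardinal_le (card_le_eql (card_setT A)).
  by apply: card_le_trans An _; exact: card_leT.
move=> /small_cardinal/(small_image val); apply: small_sub => x Ax.
by exists (exist _ x (mem_set Ax)).
Qed.

Definition reach T (r : T -> T -> Prop) (a : T) : set T := fun b =>
  forall A : set T, A a -> (forall x y, A x -> r x y -> A y) -> A b.

Lemma reach_refl T (r : T -> T -> Prop) a : reach r a a.
Proof. by []. Qed.

Lemma reach_step T (r : T -> T -> Prop) a x y : reach r a x -> r x y -> reach r a y.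
Proof. by move=> ax xy A Aa Ar; apply: (Ar x y) xy; apply: ax. Qed.

Lemma small_reach K T (r : T -> T -> Prop) a : cardinal_infinite K ->
  (forall x, small K (r x)) -> small K (reach r a).
Proof.
move=> Kinf /choice[s sP]; apply: small_le (cardinal_seq Kinf) _.
pose code := fix code (l : seq K) b :=
  if l is k :: l' then exists2 x, code l' x & s x k b else b = a.
exists code; split.
  elim=> [|k l IH] x y /=; first by move=> -> ->.
  by move=> [u /IH lu ux] [v /lu <-]; have [sfun _] := sP u; apply: sfun.
move=> b ab; apply: (ab (fun b => exists l, code l b)); first by exists nil.
move=> x y [l lx] xy; have [_ /(_ y xy)[k ky]] := sP x.
by exists (k :: l), x.
Qed.

(** * Submodules, isomorphisms and subquotients *)

Section Submodules.
Variables (R : pzRingType) (M : lmodType R).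
Implicit Types A B X : set M.

Definition is_sub A := A 0 /\ forall a x y, A x -> A y -> A (a *: x + y).

Lemma is_sub0 A : is_sub A -> A 0.
Proof. by case. Qed.

Lemma is_subD A x y : is_sub A -> A x -> A y -> A (x + y).
Proof. by move=> [_ AZD] Ax Ay; rewrite -[x]scale1r; apply: AZD. Qed.

Lemma is_subZ A a x : is_sub A -> A x -> A (a *: x).
Proof. by move=> [A0 AZD] Ax; rewrite -[_ *: x]addr0; apply: AZD. Qed.

Lemma is_subN A x : is_sub A -> A x -> A (- x).
Proof. by move=> sA Ax; rewrite -scaleN1r; apply: is_subZ. Qed.

Lemma is_subB A x y : is_sub A -> A x -> A y -> A (x - y).
Proof. by move=> sA Ax Ay; apply: is_subD => //; apply: is_subN. Qed.

Lemma is_subI A B : is_sub A -> is_sub B -> is_sub (A `&` B).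
Proof.
by move=> [A0 AZ] [B0 BZ]; split=> // a x y [Ax Bx] [Ay By]; split; [apply: AZ|apply: BZ].
Qed.

Definition hull X : set M := fun x => forall A, is_sub A -> X `<=` A -> A x.

Lemma hull_sub X : is_sub (hull X).
Proof.
split=> [A [A0 _] _ //|a x y Xx Xy A sA XA].
by case: (sA) => _; apply; [apply: Xx|apply: Xy].
Qed.

Lemma sub_hull X : X `<=` hull X.
Proof. by move=> x Xx A _; apply. Qed.

Lemma hull_min X A : is_sub A -> X `<=` A -> hull X `<=` A.
Proof. by move=> sA XA x; apply. Qed.

Lemma hullS X Y : X `<=` Y -> hull X `<=` hull Y.
Proof.
by move=> XY; apply: hull_min; [exact: hull_sub|apply: subset_trans XY (@sub_hull _)].
Qed.

Lemma small_hull K X : cardinal_infinite K -> cardinal_le R K -> small K X ->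
  small K (hull X).
Proof.
move=> Kinf RK [s [sfun sX]]; apply: small_le (cardinal_seq Kinf) _.
have KK : cardinal_le (R * K)%type K.
  apply: cardinal_le_trans (cardinal_square Kinf); have /cardinal_leP[f finj] := RK.
  by apply/cardinal_leP; exists (fun rk => (f rk.1, rk.2)) => -[a k] [b l] [/finj-> ->].
have SS : cardinal_le (seq (R * K)) (seq K).
  have /cardinal_leP[f finj] := KK; apply/cardinal_leP; exists (map f).
  exact: inj_map.
apply: small_le SS _.
pose comb := fix comb (l : seq (R * K)) x :=
  if l is ak :: l' then exists g y, [/\ s ak.2 g, comb l' y & x = ak.1 *: g + y]
  else x = 0.
exists comb; split.
  elim=> [|[a k] l IH] x y /=; first by move=> -> ->.
  move=> [g [u [kg lu ->]]] [g' [u' [kg' lu' ->]]].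
  by rewrite (sfun _ _ _ kg kg') (IH _ _ lu lu').
move=> x Xx; apply: (Xx (fun x => exists l, comb l x)).
  split=> [|a x1 x2 [l1 x1E] [l2 x2E]]; first by exists nil.
  elim: l1 x1 x1E => [|[b k] l IH] y /=.
    by move=> ->; exists l2; rewrite scaler0 add0r.
  move=> [g [u [kg /IH[m mE] ->]]]; exists ((a * b, k) :: m), g, (a *: u + x2).
  by split=> //=; rewrite scalerDr scalerA addrA.
by move=> g /sX[k kg]; exists [:: (1, k)], g, 0; split; rewrite //= scale1r addr0.
Qed.

Definition sub_pred A (sA : is_sub A) : {pred M} := [pred x | `[< A x >]].

Lemma sub_pred_closed A (sA : is_sub A) : submod_closed (sub_pred sA).
Proof.
case: (sA) => A0 AZ; split=> [|a x y]; first exact/asboolP.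
by move=> /asboolP Ax /asboolP Ay; apply/asboolP/AZ.
Qed.

End Submodules.

HB.instance Definition _ (R : pzRingType) (M : lmodType R) (A : set M) (sA : is_sub A) :=
  GRing.isSubmodClosed.Build R M (sub_pred sA) (sub_pred_closed sA).

Definition sub_closed (R : pzRingType) (M : lmodType R) (A : set M) (sA : is_sub A) :
  submodClosed M := sub_pred sA.

Section LinearMaps.
Variables (R : pzRingType).

Lemma sub_closedE (M : lmodType R) (A : set M) (sA : is_sub A) x :
  x \in sub_closed sA <-> A x.
Proof. by split=> [/asboolP|Ax] //; apply/asboolP. Qed.

Lemma submodClosed_sub (M : lmodType R) (A : submodClosed M) : is_sub [set x | x \in A].
Proof.
by split=> [|a x y Ax Ay] /=; [exact: rpred0|apply: rpredD => //; apply: rpredZ].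
Qed.

Definition linear_of (M N : lmodType R) (f : M -> N) (flin : linear f) := f.
HB.instance Definition _ (M N : lmodType R) (f : M -> N) (flin : linear f) :=
  GRing.isLinear.Build R M N *:%R (linear_of flin) flin.

Lemma isomorphicP (M N : lmodType R) (f : M -> N) :
  linear f -> (forall x, f x = 0 -> x = 0) -> (forall y, exists x, f x = y) ->
  isomorphic M N.
Proof.
move=> flin finj /choice[g gK]; exists (linear_of flin); exists g => // x.
have fB u v : f (u - v) = f u - f v.
  by rewrite addrC -scaleN1r flin scaleN1r addrC.
by apply/subr0_eq/finj; rewrite fB gK subrr.
Qed.

Lemma isomorphic_sym (M N : lmodType R) : isomorphic M N -> isomorphic N M.
Proof.
move=> [f [g fK gK]]; apply: (@isomorphicP _ _ g).
- by move=> a x y; apply: (can_inj fK); rewrite gK linearP !gK.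
- by move=> x gx; rewrite -(gK x) gx linear0.
- by move=> y; exists (f y).
Qed.

Lemma isomorphic_trans (N M P : lmodType R) :
  isomorphic M N -> isomorphic N P -> isomorphic M P.
Proof.
move=> [f [f' fK f'K]] [g [g' gK g'K]]; apply: (@isomorphicP _ _ (g \o f)).
- by move=> a x y; rewrite /= !linearP.
- by move=> x /= gfx; apply: (can_inj fK); apply: (can_inj gK); rewrite gfx !linear0.
- by move=> y; exists (f' (g' y)); rewrite /= f'K g'K.
Qed.

Lemma isomorphic_cardinal (M N : lmodType R) : isomorphic M N -> cardinal_eq M N.
Proof. by move=> [f fbij]; apply/cardinal_eqP; exists f. Qed.

(* [f] identifies [B / A] with [N]; its values outside [B] are irrelevant. *)
Definition quotient_map (M N : lmodType R) (A B : set M) (f : M -> N) :=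
  [/\ forall a x y, B x -> B y -> f (a *: x + y) = a *: f x + f y,
      forall n, exists2 x, B x & f x = n
    & forall x, B x -> (f x = 0 <-> A x)].

Lemma quotient_piP (M : lmodType R) (A : submodClosed M) a (x y : M) :
  (\pi_(quotient_module A) (a *: x + y) = a *: \pi_(quotient_module A) x +
     \pi_(quotient_module A) y)%qT.
Proof. by rewrite quotient_piD -quotient_scale_pi. Qed.

Lemma quotient_pi0 (M : lmodType R) (A : submodClosed M) :
  (\pi_(quotient_module A) 0 = 0)%qT.
Proof. by apply: (addIr (\pi_(quotient_module A) 0)%qT); rewrite -quotient_piD !add0r. Qed.

Lemma subquotientP (M N : lmodType R) (A B : submodClosed M) :
  {subset A <= B} ->
  (isomorphic (subquotient A B) N <->
   exists f : M -> N, quotient_map [set x | x \in A] [set x | x \in B] f).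
Proof.
move=> sAB; pose pi x : subquotient A B := (\pi_(quotient_module (@submod_trace R M A B)) x)%qT.
have piE (x y : submodule B) : pi x = pi y <-> submodule_val x - submodule_val y \in A.
  exact: quotient_eqP.
split=> [[g [h gK hK]]|[f [flin fsurj fker]]].
  pose F x := if pselect (x \in B) is left Bx then g (pi (Submodule Bx)) else 0.
  have FE (x : submodule B) : F (submodule_val x) = g (pi x).
    rewrite /F; case: pselect => [Bx|]; last by case: x.
    by congr (g (pi _)); apply: val_inj.
  exists F; split=> [a x y Bx By|n|x Bx].
  - rewrite -[x]/(submodule_val (Submodule Bx)) -[y]/(submodule_val (Submodule By)).
    rewrite !FE -[_ + _]/(submodule_val (a *: Submodule Bx + Submodule By)) FE.
    by rewrite /pi quotient_piP linearP.
  - exists (submodule_val (repr (h n))); first by case: (repr _).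
    by rewrite FE /pi reprK hK.
  - rewrite -[x]/(submodule_val (Submodule Bx)) FE -(linear0 g).
    rewrite -(quotient_pi0 (@submod_trace R M A B)) -[(\pi_(_) 0)%qT]/(pi 0).
    split=> [/(can_inj gK)/piE|Ax]; first by rewrite /= subr0.
    by congr (g _); apply/piE; rewrite /= subr0.
have fB x y : x \in B -> y \in B -> f x = f y <-> x - y \in A.
  move=> Bx By; have fE : f (x - y) = f x - f y.
    by rewrite addrC -scaleN1r flin // scaleN1r addrC.
  have [fA Af] := fker _ (is_subB (submodClosed_sub B) Bx By).
  by split=> [xy|/Af]; [apply: fA; rewrite fE xy subrr|rewrite fE => /subr0_eq].
apply: (@isomorphicP _ _ (fun q : subquotient A B => f (submodule_val (repr q)))).
- move=> a; elim/quotW=> x; elim/quotW=> y; rewrite -quotient_piP.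
  have fpi z : f (submodule_val (repr (pi z))) = f (submodule_val z).
    apply/fB; [by case: (repr _)|by case: z|apply/piE; exact: reprK].
  have := flin a (submodule_val x) (submodule_val y).
  by rewrite -(fpi x) -(fpi y) => <-; [exact: fpi|case: (x)|case: (y)].
- move=> q /fker qA; rewrite -[q]reprK -[RHS]quotient_pi0; apply/piE.
  by rewrite /= subr0 qA //; case: (repr _).
- move=> n; have [x Bx <-] := fsurj n; exists (pi (Submodule Bx)).
  apply/fB => //; first by case: (repr _).
  by apply/(piE _ (Submodule Bx)); apply: reprK.
Qed.
End LinearMaps.

(** * Well-orders and filtrations *)

Section WellOrders.
Variable S : Type.
Implicit Types (lt : S -> S -> Prop) (le : rel S) (a b c : S).

Definition strict_wo lt :=
  [/\ forall a b c, lt a b -> lt b c -> lt a c,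
      forall a b, [\/ lt a b, a = b | lt b a]
    & well_founded lt].

Lemma wf_irrefl lt a : well_founded lt -> ~ lt a a.
Proof. by move=> /(_ a); elim=> b _ IH bb; exact: (IH _ bb bb). Qed.

Lemma strict_wo_min lt (A : set S) : strict_wo lt -> A !=set0 ->
  exists2 m, A m & forall b, A b -> ~ lt b m.
Proof.
move=> [_ _ wf] [a]; elim: {a}(wf a) => a _ IH Aa.
have [[b [Ab ba]]|nob] := pselect (exists b, A b /\ lt b a); first exact: IH ba Ab.
by exists a => // b Ab ba; apply: nob; exists b.
Qed.

Lemma strict_wo_of_well_order le : well_order le ->
  [/\ strict_wo (slt le), forall a, le a a & forall a b, le a b -> a <> b -> slt le a b].
Proof.
move=> wo.
have min2 a b : exists2 m, m = a \/ m = b & le m a /\ le m b.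
  have [|m [[/asboolP mab mle] _]] := wo [pred x | `[< x = a \/ x = b >]].
    by exists a; apply/asboolP; left.
  by exists m => //; split; apply: mle; apply/asboolP; [left|right].
have refl a : le a a by have [m [->|->] []] := min2 a a.
have anti a b : le a b -> le b a -> a = b.
  move=> ab ba; have [|m [_ muniq]] := wo [pred x | `[< x = a \/ x = b >]].
    by exists a; apply/asboolP; left.
  by rewrite -(muniq a) ?(muniq b) //; split; try (apply/asboolP; tauto);
    move=> x /asboolP[] ->.
have tot a b : le a b \/ le b a by have [m [->|->] []] := min2 a b; tauto.
have trans a b c : le a b -> le b c -> le a c.
  move=> ab bc; have [|m [[/asboolP mE mle] _]] :=
    wo [pred x | `[< [\/ x = a, x = b | x = c] >]].
    by exists a; apply/asboolP; constructor 1.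
  have [ma mb mc] : [/\ le m a, le m b & le m c].
    by split; apply: mle; apply/asboolP; [constructor 1|constructor 2|constructor 3].
  case: mE => mE; subst m => //.
    by rewrite (anti a b).
  by rewrite -(anti b c).
split; [|exact: refl|by []].
split=> [a b c [ab nab] [bc nbc]|a b|a].
- split; first exact: (trans a b c).
  by move=> ac; subst c; apply: nab; apply: anti.
- have [->|ab] := pselect (a = b); first by constructor 2.
  have [le_ab|le_ba] := tot a b; first by constructor 1.
  by constructor 3; split=> // /esym.
- apply: contrapT => nacc; have [|m [[/asboolP macc mle] _]] :=
    wo [pred x | `[< ~ Acc (slt le) x >]]; first by exists a; apply/asboolP.
  apply: macc; constructor=> b [bm nbm]; apply: contrapT => bacc; apply: nbm.
  by apply: anti => //; apply: mle; apply/asboolP.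
Qed.

Lemma well_order_of_strict_wo lt (le := fun a b => `[< a = b \/ lt a b >]) :
  strict_wo lt -> well_order le /\ forall a b, slt le a b <-> lt a b.
Proof.
move=> swo; have [trans tot wf] := swo; split=> [A [a Aa]|a b]; last first.
  split=> [[/asboolP[]//]|ab]; split; first by apply/asboolP; right.
  by move=> abE; move: ab; rewrite abE; apply: wf_irrefl.
have [|m Am mmin] := @strict_wo_min _ (fun x => x \in A) swo; first by exists a.
exists m; split=> [|x [Ax xmin]].
  split=> // x Ax; apply/asboolP; have nxm := mmin x Ax.
  by have [mx|->|xm] := tot m x; [right|left|].
by have /asboolP[->//|xm] := xmin m Am; case: (mmin x Ax xm).
Qed.

End WellOrders.

Lemma exists_strict_wo (S : Type) : exists lt : S -> S -> Prop, strict_wo lt.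
Proof.
have [le /strict_wo_of_well_order[swo _ _]] := @well_ordering_principle {classic S}.
by exists (slt le).
Qed.

Section Filtrations.
Variables (R : pzRingType) (C : lmodType R -> Prop) (M : lmodType R).

Definition below S (lt : S -> S -> Prop) (G : S -> set M) (a : S) : set M :=
  [set x | x = 0 \/ exists2 b, lt b a & G b x].

Definition factor (A B : set M) : Prop :=
  B `<=` A \/ exists2 N, C N & exists f : M -> N, quotient_map A B f.

(* A filtration in which factors may vanish and no distinction is made between
   successor and limit steps: [G a / below a] plays the role of
   [M_(a + 1) / M_a]. *)
Definition is_lax_filtration S (lt : S -> S -> Prop) (G : S -> set M) :=
  [/\ strict_wo lt, forall a, is_sub (G a), forall a b, lt a b -> G a `<=` G b,
      forall x, x <> 0 -> exists a, G a x & forall a, factor (below lt G a) (G a)].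

Section Below.
Variables (S : Type) (lt : S -> S -> Prop) (G : S -> set M).
Hypothesis wo : strict_wo lt.
Hypothesis Gsub : forall a, is_sub (G a).
Hypothesis Gmono : forall a b, lt a b -> G a `<=` G b.

Lemma below_is_sub a : is_sub (below lt G a).
Proof.
have [trans tot _] := wo; split=> [|r x y]; first by left.
move=> [->|[b ba Gx]]; first by rewrite scaler0 add0r.
move=> [->|[c ca Gy]]; right; first by exists b; rewrite // addr0; apply: is_subZ.
have [bc|bcE|cb] := tot b c.
- by exists c => //; case: (Gsub c) => _; apply=> //; apply: Gmono Gx.
- by exists b => //; case: (Gsub b) => _; apply; rewrite // bcE.
- by exists b => //; case: (Gsub b) => _; apply=> //; apply: Gmono Gy.
Qed.

Lemma below_subset a : below lt G a `<=` G a.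
Proof. by move=> x [->|[b /Gmono]]; [apply: is_sub0|apply]. Qed.

Lemma below_jump a x : G a x -> x <> 0 ->
  exists b, [/\ b = a \/ lt b a, G b x & ~ below lt G b x].
Proof.
move=> Gx x0; have [|b Gb bmin] := @strict_wo_min _ _ (fun b => G b x) wo; first by exists a.
exists b; split=> //.
  by have [_ tot _] := wo; have [|->|/(bmin _ Gx)] := tot b a; [right|left|].
by move=> [//|[c cb Gc]]; apply: bmin cb.
Qed.

End Below.

Lemma lax_of_Filt : Filt C M ->
  exists (S : Type) (lt : S -> S -> Prop) (G : S -> set M), is_lax_filtration lt G.
Proof.
move=> [S [le [F [wo [Fmono F0 Fcov Flim Fsucc]]]]].
have [swo lexx leW] := strict_wo_of_well_order wo; have [trans tot wf] := swo.
exists S, (slt le), (fun a x => x \in F a); split; first exact: swo.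
- by move=> a; apply: submodClosed_sub.
- by move=> a b [ab _] x; apply: Fmono.
- by move=> x _; apply: Fcov.
move=> a.
have [lim|nlim] := pselect (is_limit le a).
  by left=> x /(Flim _ lim)[b ba xb]; right; exists b.
have [zero|nzero] := pselect (is_zero le a).
  by left=> x /(F0 _ zero) ->; left.
have [b bsucc] : exists b, is_succ le b a.
  by apply: contrapT => nsucc; apply: nlim; split=> // b ba; apply: nsucc; exists b.
right; have [N CN /subquotientP] := Fsucc _ _ bsucc.
have [ba _] := bsucc; case=> [|f]; first by apply: Fmono; case: ba.
move=> fmap; exists N => //; exists f.
suff -> : below (slt le) (fun a x => x \in F a) a = (fun x => x \in F b) by [].
apply/seteqP; split=> [x|x xb]; last by right; exists b.
move=> [->|[c ca xc]]; first exact: rpred0.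
have [cb|<-//|bc] := tot c b; first by apply: Fmono xc; case: cb.
by have [_ /(_ c)[]] := bsucc.
Qed.

Lemma Filt_of_lax S (lt : S -> S -> Prop) (G : S -> set M) :
  is_lax_filtration lt G -> Filt C M.
Proof.
move=> [wo Gsub Gmono Gcov Gfac]; have [trans tot wf] := wo.
pose jumps := {a | ~ (G a `<=` below lt G a)}.
pose ltT (o o' : option jumps) : Prop :=
  match o, o' with
  | Some a, Some b => lt (sval a) (sval b)
  | Some _, None => True
  | None, _ => False
  end.
have ltT_wo : strict_wo ltT.
  split.
  - by move=> [a|] [b|] [c|] //=; apply: trans.
  - move=> [a|] [b|] /=; [|by constructor 1|by constructor 3|by constructor 2].
    have [ab|abE|ba] := tot (sval a) (sval b); [by constructor 1| |by constructor 3].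
    constructor 2; congr Some; case: a b abE => [a ?] [b ?] /= abE.
    by subst b; congr exist; apply: Prop_irrelevance.
  - have accS a : Acc ltT (Some a).
      case: a => a; elim: {a}(wf a) => a _ IH aj; constructor=> -[[b bj]|] /= ba; last by [].
      exact: IH.
    by move=> [a|]; [exact: accS|constructor=> -[a|] /= ao; [exact: accS|by []]].
have [wole sltE] := well_order_of_strict_wo ltT_wo.
set le := (fun a b => _) in wole sltE.
pose F (o : option jumps) : submodClosed M := if o is Some a
  then sub_closed (below_is_sub wo Gsub Gmono (sval a))
  else sub_closed (hull_sub [set: M]).
have FN x : x \in F None by apply: (sub_closedE (hull_sub [set: M]) x).2; exact: sub_hull.
have FS a x : x \in F (Some a) <-> below lt G (sval a) x by apply: sub_closedE.
have FI a o x : ltT (Some a) o -> G (sval a) x -> x \in F o.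
  by case: o => [b|] //= ab Gx; apply/FS; right; exists (sval a).
have FE o x : x \in F o -> x <> 0 -> exists2 a, ltT (Some a) o & G (sval a) x.
  have jump a : G a x -> x <> 0 -> exists2 b : jumps, sval b = a \/ lt (sval b) a & G (sval b) x.
    move=> Gx x0; have [b [ba Gb nb]] := below_jump wo Gx x0.
    have bj : ~ (G b `<=` below lt G b) by move=> /(_ x Gb).
    by exists (exist _ b bj).
  case: o => [a|_] x0 /=; last first.
    have [a Ga] := Gcov x x0; have [b _ Gb] := jump a Ga x0.
    by exists b.
  move: x0 => /FS[//|[b ba Gb]] x0; have [c cb Gc] := jump b Gb x0.
  by exists c => //; case: cb => [->//|cb]; apply: trans cb ba.
have Fmono o o' x : ltT o o' -> x \in F o -> x \in F o'.
  case: o => // a ao /FS ax; apply: FI ao _; exact: below_subset ax.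
exists (option jumps), le, F; split; [exact: wole|split].
- by move=> o o' /asboolP[->//|oo'] x; apply: Fmono.
- move=> o zero x; split=> [xo|->]; last exact: rpred0.
  by apply: contrapT => /(FE _ _ xo)[a /sltE/zero].
- by move=> x; exists None.
- move=> o [nz ns] x; split=> [xo|[o' /sltE o'o]]; last exact: Fmono.
  have [->|x0] := pselect (x = 0).
    have /existsNP[o' /contrapT o'o] := nz.
    by exists o' => //; apply: rpred0.
  have [a ao Ga] := FE _ _ xo x0.
  have := ns (Some a); rewrite /is_succ => /not_andP[/sltE//|].
  move=> /existsNP[o' /contrapT[/sltE ao' o'o]].
  by exists o' => //; apply: FI Ga.
- move=> [a|] o [/sltE ao nbetween] //=.
  have Flow : [set x | x \in F (Some a)] = below lt G (sval a).
    by apply/seteqP; split=> x /FS.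
  have Fhigh : [set x | x \in F o] = G (sval a).
    apply/seteqP; split=> x; last exact: FI.
    move=> xo; have [->|x0] := pselect (x = 0); first exact: is_sub0.
    have [b bo Gb] := FE _ _ xo x0.
    have [ba|<-//|ab] := tot (sval b) (sval a); first exact: (Gmono _ _ ba).
    by exfalso; apply: (nbetween (Some b)); split; apply/sltE.
  have [|[N CN [f fmap]]] := Gfac (sval a); first by case: (a).
  exists N => //; apply/subquotientP; first by move=> x; exact: (Fmono (Some a) o x ao).
  by exists f; rewrite Flow Fhigh.
Qed.

End Filtrations.

(** * Direct sums *)

Section Product.
Variables (R : pzRingType) (I : Type) (M : I -> lmodType R).

Definition dprod : Type := forall i, M i.

HB.instance Definition _ := gen_eqMixin dprod.
HB.instance Definition _ := gen_choiceMixin dprod.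

Let addf (x y : dprod) : dprod := fun i => x i + y i.
Let oppf (x : dprod) : dprod := fun i => - x i.
Let zerof : dprod := fun i => 0.
Let scalef (a : R) (x : dprod) : dprod := fun i => a *: x i.

Fact dprod_addA : associative addf.
Proof. by move=> x y z; apply: functional_extensionality_dep => i; apply: addrA. Qed.
Fact dprod_addC : commutative addf.
Proof. by move=> x y; apply: functional_extensionality_dep => i; apply: addrC. Qed.
Fact dprod_add0 : left_id zerof addf.
Proof. by move=> x; apply: functional_extensionality_dep => i; apply: add0r. Qed.
Fact dprod_addN : left_inverse zerof oppf addf.
Proof. by move=> x; apply: functional_extensionality_dep => i; apply: addNr. Qed.

HB.instance Definition _ := GRing.isZmodule.Build dprod
  dprod_addA dprod_addC dprod_add0 dprod_addN.

Fact dprod_scaleA a b x : scalef a (scalef b x) = scalef (a * b) x.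
Proof. by apply: functional_extensionality_dep => i; apply: scalerA. Qed.
Fact dprod_scale1 : left_id 1 scalef.
Proof. by move=> x; apply: functional_extensionality_dep => i; apply: scale1r. Qed.
Fact dprod_scaleDr : right_distributive scalef +%R.
Proof. by move=> a x y; apply: functional_extensionality_dep => i; apply: scalerDr. Qed.
Fact dprod_scaleDl x : {morph scalef^~ x : a b / a + b}.
Proof. by move=> a b; apply: functional_extensionality_dep => i; apply: scalerDl. Qed.

HB.instance Definition _ := GRing.Zmodule_isLmodule.Build R dprod
  dprod_scaleA dprod_scale1 dprod_scaleDr dprod_scaleDl.

Definition finsupp (x : dprod) : Prop := finite_set [set i | x i <> 0].

Fact finsupp_sub : is_sub finsupp.
Proof.
split=> [|a x y fx fy]; first by apply: (@sub_finite_set _ _ set0) => // i; apply.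
apply: (@sub_finite_set _ _ ([set i | x i <> 0] `|` [set i | y i <> 0])).
  move=> i /= xyi; have [xi|xi] := pselect (x i = 0); last by left.
  right=> yi; apply: xyi; rewrite -[LHS]/(a *: x i + y i) xi yi.
  by rewrite scaler0 addr0.
by rewrite finite_setU.
Qed.

Definition dsum : lmodType R := submodule (sub_closed finsupp_sub).

Definition dcoord (i : I) (x : dsum) : M i := submodule_val x i.

Lemma dcoordP a i x y : dcoord i (a *: x + y) = a *: dcoord i x + dcoord i y.
Proof. by []. Qed.

Lemma dcoordD i x y : dcoord i (x + y) = dcoord i x + dcoord i y.
Proof. by []. Qed.

Lemma dcoordN i x : dcoord i (- x) = - dcoord i x.
Proof. by []. Qed.

Lemma dcoord0 i : dcoord i 0 = 0.
Proof. by []. Qed.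

Lemma dcoord_inj x y : (forall i, dcoord i x = dcoord i y) -> x = y.
Proof. by move=> xy; apply: val_inj; apply: functional_extensionality_dep. Qed.

Lemma dcoord_finite x : finite_set [set i | dcoord i x <> 0].
Proof. exact: (sub_closedE finsupp_sub _).1 (submodule_valP x). Qed.

Definition mk_dsum (f : forall i, M i) (ff : finite_set [set i | f i <> 0]) : dsum :=
  @Submodule R _ (sub_closed finsupp_sub) f (iffRL (sub_closedE finsupp_sub f) ff).

Lemma dcoord_mk f ff i : dcoord i (@mk_dsum f ff) = f i.
Proof. by []. Qed.

Let single i (m : M i) j : M j :=
  if pselect (i = j) is left ij then ecast k (M k) ij m else 0.

Fact single_finite i (m : M i) : finite_set [set j | single m j <> 0].
Proof.
apply: (@sub_finite_set _ _ [set i]) => // j /=; rewrite /single.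
by case: pselect.
Qed.

Definition dinj i (m : M i) : dsum := mk_dsum (single_finite m).

Lemma dcoord_injE i (m : M i) : dcoord i (dinj m) = m.
Proof.
rewrite dcoord_mk /single; case: pselect => // ii.
by rewrite (Prop_irrelevance ii erefl).
Qed.

Lemma dinj_injective i : injective (@dinj i).
Proof. by move=> m n mn; rewrite -(dcoord_injE m) mn dcoord_injE. Qed.

Lemma dcoord_inj0 i (m : M i) j : i <> j -> dcoord j (dinj m) = 0.
Proof. by move=> ij; rewrite dcoord_mk /single; case: pselect. Qed.

Lemma dinjP i a (m n : M i) : dinj (a *: m + n) = a *: dinj m + dinj n.
Proof.
apply: dcoord_inj => j; rewrite dcoordP.
have [ij|ij] := pselect (i = j); first by subst j; rewrite !dcoord_injE.
by rewrite !dcoord_inj0 // scaler0 addr0.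
Qed.

Fact dmask_finite (J : set I) x :
  finite_set [set i | (if pselect (J i) then dcoord i x else 0) <> 0].
Proof.
by apply: sub_finite_set (dcoord_finite x) => i /=; case: pselect.
Qed.

Definition dmask (J : set I) (x : dsum) : dsum := mk_dsum (dmask_finite J x).

Lemma dcoord_dmask J x i : J i -> dcoord i (dmask J x) = dcoord i x.
Proof. by rewrite dcoord_mk; case: pselect. Qed.

Lemma dcoord_dmask0 J x i : ~ J i -> dcoord i (dmask J x) = 0.
Proof. by rewrite dcoord_mk; case: pselect. Qed.

Lemma dmaskP J a x y : dmask J (a *: x + y) = a *: dmask J x + dmask J y.
Proof.
apply: dcoord_inj => i; rewrite dcoordP.
have [Ji|Ji] := pselect (J i); first by rewrite !dcoord_dmask.
by rewrite !dcoord_dmask0 // scaler0 addr0.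
Qed.

Lemma dmask_id J x : (forall i, dcoord i x <> 0 -> J i) -> dmask J x = x.
Proof.
move=> xJ; apply: dcoord_inj => i; have [Ji|Ji] := pselect (J i).
  exact: dcoord_dmask.
by rewrite dcoord_dmask0 //; apply/esym; apply: contrapT => xi; apply: Ji; exact: xJ xi.
Qed.

Lemma dsum_ind (J : set I) (A : set dsum) x : is_sub A ->
  (forall i (m : M i), J i -> A (dinj m)) ->
  (forall i, dcoord i x <> 0 -> J i) -> A x.
Proof.
move=> sA Ainj.
have [n] : exists n, ([set i | dcoord i x <> 0] #= `I_n)%card.
  exact/finite_setP/dcoord_finite.
elim: n x => [|n IH] x /=.
  rewrite II0 card_eq0 => /eqP x0 _; suff -> : x = 0 by apply: is_sub0.
  apply: dcoord_inj => i; apply: contrapT => xi.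
  by have : [set i | dcoord i x <> 0] i by []; rewrite x0.
move=> /eq_cardSP[i xi xn] xJ.
suff : A (dinj (dcoord i x) + (x - dinj (dcoord i x))) by rewrite addrC subrK.
have rest j : dcoord j (x - dinj (dcoord i x)) <> 0 <-> dcoord j x <> 0 /\ j <> i.
  rewrite dcoordD dcoordN; have [->|ij] := pselect (j = i).
    by rewrite dcoord_injE subrr; split=> [|[]].
  by rewrite dcoord_inj0 ?oppr0 ?addr0; [tauto|exact: nesym].
apply: is_subD => //; first exact/Ainj/xJ.
apply: IH => [|j /rest[xj _]]; last exact: xJ xj.
rewrite (_ : mkset _ = [set i | dcoord i x <> 0] `\ i) //.
by apply/seteqP; split=> j /rest.
Qed.

Section Lift.
Variables (N : lmodType R) (f : forall i, M i -> N).
Hypothesis flin : forall i, linear (@f i).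
Implicit Type x : dsum.

Let supp x : {fset {classic I}} := fset_set ([set i | dcoord i x <> 0] : set {classic I}).

Definition dlift x : N := \sum_(i <- supp x) f (dcoord i x).

Let f0 i : f (0 : M i) = 0.
Proof. by have := flin (-1) (0 : M i) 0; rewrite !scaleN1r !addNr. Qed.

Let supp_out x i : i \notin supp x -> dcoord i x = 0.
Proof.
move=> /negP; rewrite in_fset_set; last exact: dcoord_finite.
by move=> xi; apply: contrapT => xi0; apply: xi; apply: mem_set.
Qed.

Let dliftE x (s : {fset {classic I}}) : (supp x `<=` s)%fset ->
  dlift x = \sum_(i <- s) f (dcoord i x).
Proof. by move=> xs; apply: big_fset_incl => // i _ /supp_out ->; apply: f0. Qed.

Lemma dliftP : linear dlift.
Proof.
move=> a x y; pose s := (supp (a *: x + y) `|` supp x `|` supp y)%fset.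
rewrite !(dliftE (s := s)) ?fsubsetUr // ?scaler_sumr -?big_split /=; last 2 first.
- by rewrite /s fsetUAC fsubsetUr.
- by rewrite /s -fsetUA fsubsetUl.
by apply: eq_bigr => i _; exact: flin.
Qed.

Lemma dlift_inj i (m : M i) : dlift (dinj m) = f m.
Proof.
rewrite (dliftE (s := [fset (i : {classic I})]%fset)).
  by rewrite big_seq_fset1 dcoord_injE.
apply/fsubsetP => j; rewrite in_fset_set; last exact: dcoord_finite.
move=> /set_mem /= ij; rewrite inE; apply/eqP; apply: contrapT => ji.
by apply: ij; apply: dcoord_inj0; apply: nesym.
Qed.

End Lift.

Lemma dcoord_max (lt : I -> I -> Prop) x : strict_wo lt -> x <> 0 ->
  exists2 i, dcoord i x <> 0 & forall j, lt i j -> dcoord j x = 0.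
Proof.
move=> [trans tot wf] x0.
suff max n : forall A : set I, (A #= `I_n)%card -> A !=set0 ->
    exists2 m, A m & forall b, A b -> ~ lt m b.
  have [n xn] : exists n, ([set i | dcoord i x <> 0] #= `I_n)%card.
    exact/finite_setP/dcoord_finite.
  have [|m xm mmax] := max n _ xn.
    by apply: contrapT => no; apply: x0; apply: dcoord_inj => i;
      apply: contrapT => xi; apply: no; exists i.
  by exists m => // j mj; apply: contrapT => /mmax.
elim: n => [|n IH] A; first by rewrite II0 card_eq0 => /eqP -> [].
move=> /eq_cardSP[a Aa An] _.
have [[b bA]|Aa0] := pselect ((A `\ a) !=set0); last first.
  exists a => // b Ab ab; apply: Aa0; exists b; split=> // ba.
  by move: ab; rewrite ba; apply: wf_irrefl.
have [|m [Am ma] mmax] := IH _ An; first by exists b.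
have [ltma|maE|am] := tot m a; [exists a => // c Ac ac| by []|exists m => // c Ac].
  have [ca|ca] := pselect (c = a); first by move: ac; rewrite ca; apply: wf_irrefl.
  by apply: (mmax c) => //; apply: trans ltma ac.
have [->|ca] := pselect (c = a); last exact: mmax.
by move=> ma'; apply: (@wf_irrefl _ _ m wf); apply: trans ma' am.
Qed.

End Product.

Arguments dcoord : simpl never.

Section DsumTheory.
Variable R : pzRingType.

Lemma linear_image_sub (M N : lmodType R) (f : M -> N) (A : set M) :
  linear f -> is_sub A -> is_sub (f @` A).
Proof.
move=> flin [A0 AZ]; split=> [|a _ _ [x Ax <-] [y Ay <-]].
  by exists 0 => //; have := flin (-1) 0 0; rewrite !scaleN1r !addNr.
by exists (a *: x + y); [apply: AZ|rewrite flin].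
Qed.

Lemma linear_preimage_sub (M N : lmodType R) (f : M -> N) (A : set N) :
  linear f -> is_sub A -> is_sub (f @^-1` A).
Proof.
move=> flin [A0 AZ]; split=> [|a x y]; last by rewrite /preimage /= flin; apply: AZ.
by rewrite /preimage /=; have := flin (-1) 0 0; rewrite !scaleN1r !addNr => ->.
Qed.

Lemma setT_sub (M : lmodType R) : is_sub [set: M].
Proof. by []. Qed.

Lemma dsum_surjective I (M : I -> lmodType R) (N : lmodType R) (f : N -> dsum M) :
  linear f -> (forall i (m : M i), exists x, f x = dinj m) -> forall y, exists x, f x = y.
Proof.
move=> flin finj y; have [|i m _|//|x _ <-] := @dsum_ind _ _ M setT (range f) y.
- exact: linear_image_sub flin (setT_sub _).
- by have [x <-] := finj i m; exists x.
- by exists x.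
Qed.

Lemma dsum_isomorphic I (M N : I -> lmodType R) :
  (forall i, isomorphic (M i) (N i)) -> isomorphic (dsum M) (dsum N).
Proof.
move=> iso; pose f i := sval (cid (iso i)).
have fbij i : bijective (f i) := svalP (cid (iso i)).
have fin x : finite_set [set i | f i (dcoord i x) <> 0].
  apply: sub_finite_set (dcoord_finite x) => i /= fx xi; apply: fx.
  by rewrite xi linear0.
pose F x : dsum N := mk_dsum (fin x).
have Flin : linear F.
  by move=> a x y; apply: dcoord_inj => i; rewrite dcoordP !dcoord_mk dcoordP linearP.
apply: (@isomorphicP _ _ _ F) => // [x Fx0|].
  apply: dcoord_inj => i; apply: (bij_inj (fbij i)); rewrite dcoord0 linear0.
  exact: (congr1 (fun y => dcoord i y) Fx0).
apply: dsum_surjective => // i n; have [g gK fK] := fbij i.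
exists (dinj (g n)); apply: dcoord_inj => j; rewrite dcoord_mk.
have [ij|ij] := pselect (i = j); first by subst j; rewrite !dcoord_injE fK.
by rewrite !dcoord_inj0 // linear0.
Qed.

Lemma dsum_reindex I J (M : I -> lmodType R) (h : J -> I) : bijective h ->
  isomorphic (dsum M) (dsum (fun j => M (h j))).
Proof.
move=> [h' hK h'K].
have fin (x : dsum M) : finite_set [set j | dcoord (h j) x <> 0].
  apply: sub_finite_set (finite_image h' (dcoord_finite x)) => j /= xj.
  by exists (h j).
pose f (x : dsum M) : dsum (fun j => M (h j)) := mk_dsum (fin x).
have flin : linear f by move=> a x y; apply: dcoord_inj.
apply: (@isomorphicP _ _ _ f) => // [x fx0|].
  apply: dcoord_inj => i; rewrite -(h'K i) dcoord0.
  exact: (congr1 (fun y => dcoord (h' i) y) fx0).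
apply: dsum_surjective => // j m; exists (dinj m); apply: dcoord_inj => k.
rewrite dcoord_mk; have [<-|jk] := pselect (j = k); first by rewrite !dcoord_injE.
by rewrite !dcoord_inj0 // => /(can_inj hK).
Qed.

Lemma dsum_pair I J (M : I * J -> lmodType R) :
  isomorphic (dsum M) (dsum (fun i => dsum (fun j => M (i, j)))).
Proof.
have fin2 (x : dsum M) i : finite_set [set j | dcoord (i, j) x <> 0].
  apply: sub_finite_set (finite_image snd (dcoord_finite x)) => j /= xj.
  by exists (i, j).
pose f2 (x : dsum M) i : dsum (fun j => M (i, j)) := mk_dsum (fin2 x i).
have fin x : finite_set [set i | f2 x i <> 0].
  apply: sub_finite_set (finite_image fst (dcoord_finite x)) => i /= xi.
  have [[j xj]|xi0] := pselect (exists j, dcoord (i, j) x <> 0); first by exists (i, j).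
  exfalso; apply: xi; apply: dcoord_inj => j.
  by apply: contrapT => xj; apply: xi0; exists j.
pose f (x : dsum M) : dsum (fun i => dsum (fun j => M (i, j))) := mk_dsum (fin x).
have flin : linear f by move=> a x y; apply: dcoord_inj => i; apply: dcoord_inj.
apply: (@isomorphicP _ _ _ f) => // [x fx0|].
  apply: dcoord_inj => -[i j].
  exact: (congr1 (fun y => dcoord j (dcoord i y)) fx0).
apply: dsum_surjective => // i m.
have inj_lin : linear (@dinj _ _ (fun i => dsum (fun j => M (i, j))) i).
  by move=> a x y; apply: dinjP.
have := @dsum_ind _ _ _ setT (@dinj _ _ (fun i => dsum (fun j => M (i, j))) i @^-1` range f) m.
case=> [|j n _|//|x _ xE]; last by exists x.
  by apply: linear_preimage_sub => //; apply: linear_image_sub.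
exists (@dinj _ _ M (i, j) n) => //; apply: dcoord_inj => k; apply: dcoord_inj => l.
rewrite -[LHS]/(dcoord (k, l) (@dinj _ _ M (i, j) n)); have [ik|ik] := pselect (i = k).
  subst k; rewrite dcoord_injE; have [jl|jl] := pselect (j = l).
    by subst l; rewrite !dcoord_injE.
  by rewrite !dcoord_inj0 // => -[].
by rewrite [in RHS]dcoord_inj0 // dcoord_inj0 // => -[].
Qed.

Lemma dsum_support I (M : I -> lmodType R) (P : I -> Prop) :
  (forall i, ~ P i -> forall m : M i, m = 0) ->
  isomorphic (dsum M) (dsum (fun s : {i | P i} => M (sval s))).
Proof.
move=> M0; have fin (x : dsum M) : finite_set [set s : {i | P i} | dcoord (sval s) x <> 0].
  apply: (@finite_preimage _ _ [set i | dcoord i x <> 0] sval); last exact: dcoord_finite.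
  by move=> [i Pi] [j Pj] _ _ /= ij; subst j; congr exist; apply: Prop_irrelevance.
pose f (x : dsum M) : dsum (fun s : {i | P i} => M (sval s)) := mk_dsum (fin x).
have flin : linear f by move=> a x y; apply: dcoord_inj.
apply: (@isomorphicP _ _ _ f) => // [x fx0|].
  apply: dcoord_inj => i; have [Pi|nPi] := pselect (P i); last exact: M0.
  exact: (congr1 (fun y => dcoord (exist _ i Pi) y) fx0).
apply: dsum_surjective => // -[i Pi] m; exists (@dinj _ _ M i m); apply: dcoord_inj => -[j Pj].
rewrite -[LHS]/(dcoord j (@dinj _ _ M i m)); have [ij|ij] := pselect (i = j).
  subst j; rewrite dcoord_injE (Prop_irrelevance Pj Pi).
  by rewrite (@dcoord_injE _ _ (fun s : {i | P i} => M (sval s)) (exist _ i Pi)).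
by rewrite !dcoord_inj0 // => -[].
Qed.

Lemma dsum_hull I (M : I -> lmodType R) (J : set I) (x : dsum M) :
  (forall i, dcoord i x <> 0 -> J i) -> hull (\bigcup_(i in J) range (@dinj _ _ M i)) x.
Proof.
apply: dsum_ind; first exact: hull_sub.
by move=> i m Ji; apply: sub_hull; exists i => //; exists m.
Qed.

Lemma small_dsum K I (M : I -> lmodType R) (J : set I) : cardinal_infinite K ->
  cardinal_le R K -> small K J -> (forall i, cardinal_le (M i) K) ->
  small K [set x : dsum M | forall i, dcoord i x <> 0 -> J i].
Proof.
move=> Kinf RK JK MK; apply: small_sub (@dsum_hull _ _ _) _.
apply: small_hull => //; apply: small_bigcup => // i _.
by apply: small_image; apply/small_cardinal.
Qed.

Lemma cardinal_le_dsum K I (M : I -> lmodType R) : cardinal_infinite K ->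
  cardinal_le R K -> cardinal_le I K -> (forall i, cardinal_le (M i) K) ->
  cardinal_le (dsum M) K.
Proof.
move=> Kinf RK /small_cardinal IK MK; apply/small_cardinal.
by apply: small_sub (small_dsum Kinf RK IK MK).
Qed.

Lemma dsum_ge_index I (M : I -> lmodType R) :
  (forall i, exists m : M i, m <> 0) -> cardinal_le I (dsum M).
Proof.
move=> M0; pose m i := sval (cid (M0 i)).
have m0 i : m i <> 0 := svalP (cid (M0 i)).
apply/cardinal_leP; exists (fun i => dinj (m i)) => i j ij.
apply: contrapT => nij; apply: (m0 j).
by rewrite -(dcoord_injE (m j)) -ij dcoord_inj0.
Qed.

Section Lexicographic.
Variables (I : Type) (lt : I -> I -> Prop).
Variables (S : I -> Type) (ltS : forall i, S i -> S i -> Prop).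

Definition lex (p q : {i & S i}) : Prop := lt (tag p) (tag q) \/
  exists e : tag p = tag q, ltS (ecast k (S k) e (tagged p)) (tagged q).

Lemma lex_wo : strict_wo lt -> (forall i, strict_wo (@ltS i)) -> strict_wo lex.
Proof.
move=> [trans tot wf] woS; split.
- move=> [i a] [j b] [k c] [/= ij|/= [e ab]] [/= jk|/= [e' bc]].
  + by left; apply: trans ij jk.
  + by left; rewrite /= -e'.
  + by left; rewrite /= e.
  + right; subst j; subst k; exists erefl => /=.
    by have [transS _ _] := woS i; apply: transS ab bc.
- move=> [i a] [j b]; have [ij|ij|ji] := tot i j.
  + by constructor 1; left.
  + subst j; have [_ totS _] := woS i; have [ab|->|ba] := totS a b.
    * by constructor 1; right; exists erefl.
    * by constructor 2.
    * by constructor 3; right; exists erefl.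
  + by constructor 3; left.
- case=> i; elim: {i}(wf i) => i _ IHi a.
  have [_ _ wfS] := woS i; elim: {a}(wfS a) => a _ IHa.
  constructor=> -[j b] [/= ji|/= [e ba]]; first exact: IHi.
  by subst j; apply: IHa.
Qed.

End Lexicographic.

Lemma Filt_dsum (C : lmodType R -> Prop) I (M : I -> lmodType R) :
  (forall i, Filt C (M i)) -> Filt C (dsum M).
Proof.
move=> FM; have [lt wo] := exists_strict_wo I.
have lax i := lax_of_Filt (FM i).
pose S i := sval (cid (lax i)); pose lax1 i := svalP (cid (lax i)).
pose ltS i : S i -> S i -> Prop := sval (cid (lax1 i)); pose lax2 i := svalP (cid (lax1 i)).
pose G i : S i -> set (M i) := sval (cid (lax2 i)).
have laxG i : is_lax_filtration C (ltS i) (G i) := svalP (cid (lax2 i)).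
have [trans tot wf] := wo.
pose H (p : {i & S i}) : set (dsum M) :=
  [set x | (forall k, lt (tag p) k -> dcoord k x = 0) /\ G _ (tagged p) (dcoord (tag p) x)].
have cover x : x <> 0 -> exists p : {i & S i}, H p x /\ dcoord (tag p) x <> 0.
  move=> x0; have [i xi imax] := dcoord_max wo x0.
  have [_ _ _ Gcov _] := laxG i; have [a Ga] := Gcov _ xi.
  by exists (Tagged S a).
have belowH p x : H p x ->
    below (lex lt ltS) H p x <-> below (ltS _) (G _) (tagged p) (dcoord (tag p) x).
  case: p => i a [/= xk Ga]; split=> [[->|[[j b] [/= ji|/= [e ba]] [/= xj Gb]]]|bel].
  - by left.
  - by left; apply: xj.
  - by subst j; right; exists b.
  - have [->|x0] := pselect (x = 0); first by left.
    case: bel => [xi|[b ba Gb]]; last first.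
      by right; exists (Tagged S b) => //; right; exists erefl.
    have [[j b] [Hjb /= xj]] := cover x x0.
    right; exists (Tagged S b) => //; left => /=; have [//|ji|ij] := tot j i.
      by case: xj; rewrite ji.
    by case: xj; apply: xk.
apply: (@Filt_of_lax _ _ _ {i & S i} (lex lt ltS) H); split.
- by apply: lex_wo wo _ => i; have [woi _ _ _ _] := laxG i; exact: woi.
- move=> [i a]; have [_ Gsub _ _ _] := laxG i; split=> /=.
    by split=> //; apply: is_sub0.
  move=> r x y [xk Gx] [yk Gy]; split=> [k ik|] /=.
    by rewrite dcoordP xk // yk // scaler0 addr0.
  by rewrite dcoordP; case: (Gsub a) => _; apply.
- move=> [i a] [j b] /= [/= ij|/= [e ab]] x [/= xk Gx].
    split=> /= [k jk|]; first by apply: xk; apply: trans ij jk.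
    by rewrite xk //; have [_ Gsub _ _ _] := laxG j; apply: is_sub0.
  subst j; split=> //=; have [_ _ Gmono _ _] := laxG i; exact: Gmono ab _ Gx.
- by move=> x /cover[p [Hp _]]; exists p.
- move=> [i a]; have [_ Gsub _ _ Gfac] := laxG i; have [Gb|[N CN [f [flin fsurj fker]]]] := Gfac a.
    by left=> x Hx; apply/(belowH _ _ Hx)/Gb; case: Hx.
  right; exists N => //; exists (fun x => f (dcoord i x)); split.
  + by move=> r x y [_ Gx] [_ Gy]; rewrite dcoordP flin.
  + move=> n; have [m Gm fm] := fsurj n; exists (dinj m); last by rewrite dcoord_injE.
    split=> /= [k ik|]; last by rewrite dcoord_injE.
    by rewrite dcoord_inj0 // => ki; move: ik; rewrite ki; apply: wf_irrefl.
  + move=> x Hx; rewrite fker; last by case: Hx.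
    by split=> /(belowH _ _ Hx).
Qed.

End DsumTheory.

(** * Hill's lemma and direct summands *)

Section Hill.
Variables (R : pzRingType) (C : lmodType R -> Prop) (K : Type).
Hypothesis Kinf : cardinal_infinite K.
Hypothesis RK : cardinal_le R K.
Hypothesis CK : forall N, C N -> cardinal_le N K.

Lemma exists_small_supplement (M : lmodType R) (A B : set M) :
  is_sub B -> factor C A B -> is_sub A ->
  exists D : set M, [/\ is_sub D, small K D, D `<=` B &
    forall x, B x -> exists2 y, D y & A (x - y)].
Proof.
move=> sB [BA|[N CN [f [flin fsurj fker]]]] sA.
  exists [set 0]; split.
  - by split=> // a x y -> ->; rewrite scaler0 addr0.
  - exact: finite_small.
  - by move=> _ ->; apply: is_sub0.
  - by move=> x /BA Ax; exists 0; rewrite // subr0.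
have /choice[s sP] n : exists x, B x /\ f x = n by have [x] := fsurj n; exists x.
exists (hull (range s)); split.
- exact: hull_sub.
- apply: small_hull => //; apply: small_image; apply/small_cardinal; exact: CK.
- by apply: hull_min => // _ [n _ <-]; have [] := sP n.
- move=> x Bx; have [Bs fs] := sP (f x); exists (s (f x)); first by apply: sub_hull; exists (f x).
  apply/fker; first exact: (is_subB sB).
  by rewrite -scaleN1r addrC flin // scaleN1r fs addNr.
Qed.

Variables (M : lmodType R) (S : Type) (lt : S -> S -> Prop) (G : S -> set M).
Hypothesis laxG : is_lax_filtration C lt G.

Let wo : strict_wo lt. Proof. by have [wo0 _ _ _ _] := laxG; exact: wo0. Qed.
Let trans a b c : lt a b -> lt b c -> lt a c. Proof. by have [t _ _] := wo; apply: t. Qed.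
Let tot a b : [\/ lt a b, a = b | lt b a]. Proof. by have [_ t _] := wo; apply: t. Qed.
Let wf : well_founded lt. Proof. by have [_ _ t] := wo; exact: t. Qed.
Let Gsub a : is_sub (G a). Proof. by have [_ t _ _ _] := laxG; apply: t. Qed.
Let Gmono a b : lt a b -> G a `<=` G b. Proof. by have [_ _ t _ _] := laxG; apply: t. Qed.
Let bsub a : is_sub (below lt G a). Proof. exact: below_is_sub. Qed.

Definition supplements (A : S -> set M) := forall a,
  [/\ is_sub (A a), small K (A a), A a `<=` G a &
    forall x, G a x -> exists2 y, A a y & below lt G a (x - y)].

Lemma exists_supplements : exists A, supplements A.
Proof.
suff /choice[A AP] : forall a, exists D : set M, [/\ is_sub D, small K D, D `<=` G a &
    forall x, G a x -> exists2 y, D y & below lt G a (x - y)] by exists A.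
move=> a; by apply: exists_small_supplement => //; have [_ _ _ _] := laxG; apply.
Qed.

Variable A : S -> set M.
Hypothesis supA : supplements A.

Let Asub a : is_sub (A a). Proof. by have [] := supA a. Qed.
Let Asmall a : small K (A a). Proof. by have [] := supA a. Qed.
Let AG a : A a `<=` G a. Proof. by have [] := supA a. Qed.

Definition part (T : set S) : set M := hull (\bigcup_(a in T) A a).

Lemma part_sub T : is_sub (part T).
Proof. exact: hull_sub. Qed.

Lemma part0 T : part T 0.
Proof. exact: is_sub0 (part_sub T). Qed.

Lemma partS T U x : T `<=` U -> part T x -> part U x.
Proof. by move=> TU; apply: hullS; apply: bigcup_subset. Qed.

Lemma gen_part (T : set S) a x : T a -> A a x -> part T x.
Proof. by move=> Ta Ax; apply: sub_hull; exists a. Qed.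

Lemma part_min T (B : set M) : is_sub B -> (forall a, T a -> A a `<=` B) -> part T `<=` B.
Proof. by move=> sB TB; apply: hull_min => // x [a Ta Ax]; apply: (TB a). Qed.

Lemma part_set0 x : part set0 x -> x = 0.
Proof.
have s0 : is_sub [set (0 : M)] by split=> // a y z -> ->; rewrite scaler0 addr0.
suff p0 : part set0 `<=` [set 0] by apply: p0.
by apply: part_min => // a [].
Qed.

Definition upto a : set S := [set b | b = a \/ lt b a].
Definition under a : set S := [set b | lt b a].

Lemma upto_mono a b : lt a b -> upto a `<=` upto b.
Proof. by move=> ab c [->|ca]; right => //; apply: trans ca ab. Qed.

Lemma G_part a : G a `<=` part (upto a).
Proof.
elim: {a}(wf a) => a _ IH x Gx.
have [_ _ _ sup] := supA a; have [y Ay bel] := sup x Gx.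
rewrite -(subrK y x); apply: (is_subD (part_sub _)).
  case: bel => [->|[b ba Gb]]; first exact: part0.
  by apply: partS (IH b ba _ Gb); apply: upto_mono.
by apply: gen_part Ay; left.
Qed.

Lemma below_part a x : below lt G a x <-> part (under a) x.
Proof.
split=> [[->|[b ba /G_part]]|]; first exact: part0.
  by apply: partS => c [->//|cb]; apply: trans cb ba.
by apply: part_min => // b ba y /AG Gy; right; exists b.
Qed.

Lemma part_setT x : part setT x.
Proof.
have [->|x0] := pselect (x = 0); first exact: part0.
have [_ _ _ Gcov _] := laxG; have [a /G_part] := Gcov x x0.
exact: partS.
Qed.

Lemma part_union T U x : part (T `|` U) x -> exists y z, [/\ part T y, part U z & x = y + z].
Proof.
pose B x := exists y z, [/\ part T y, part U z & x = y + z].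
apply: (@part_min _ B).
  split=> [|a _ _ [y [z [Ty Uz ->]]] [y' [z' [Ty' Uz' ->]]]].
    by exists 0, 0; split; rewrite ?addr0 //; exact: part0.
  exists (a *: y + y'), (a *: z + z'); split.
  - by have [_] := part_sub T; apply.
  - by have [_] := part_sub U; apply.
  - by rewrite scalerDr addrACA.
move=> a [Ta|Ua] y Ay.
  by exists y, 0; split; [exact: gen_part Ay|exact: part0|rewrite addr0].
by exists 0, y; split; [exact: part0|exact: gen_part Ay|rewrite add0r].
Qed.

Lemma part_set1 a : part [set a] `<=` A a.
Proof. by apply: part_min => // b ->. Qed.

Lemma part_finite T x : part T x -> exists F, [/\ finite_set F, F `<=` T & part F x].
Proof.
pose B x := exists F, [/\ finite_set F, F `<=` T & part F x].
apply: (@part_min _ B).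
  split=> [|a y z [F [Ff FT Fy]] [F' [F'f F'T F'z]]].
    by exists set0; split=> //; exact: part0.
  exists (F `|` F'); split; first by rewrite finite_setU.
    by move=> b [/FT|/F'T].
  have [_] := part_sub (F `|` F'); apply; first by apply: partS Fy; left.
  by apply: partS F'z; right.
move=> a Ta y Ay; exists [set a]; split=> // [b ->//|].
exact: gen_part Ay.
Qed.

Lemma part_directed (U P : set S) (T : S -> set S) x :
  (forall a b, lt a b -> T a `<=` T b) -> part (U `|` \bigcup_(c in P) T c) x ->
  part U x \/ exists2 c, P c & part (U `|` T c) x.
Proof.
move=> Tmono; pose B x := part U x \/ exists2 c, P c & part (U `|` T c) x.
have UT c y : part U y -> part (U `|` T c) y by apply: partS; left.
have TT a b y : lt a b -> part (U `|` T a) y -> part (U `|` T b) y.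
  by move=> /Tmono TaTb; apply: partS; apply: setUS.
have pZD V r y z : part V y -> part V z -> part V (r *: y + z).
  by have [_] := part_sub V; apply.
apply: (@part_min _ B).
  split=> [|r y z [Uy|[a Pa Ty]] [Uz|[b Pb Tz]]].
  - by left; exact: part0.
  - by left; apply: pZD.
  - by right; exists b => //; apply: pZD => //; apply: UT.
  - by right; exists a => //; apply: pZD => //; apply: UT.
  - right; have [ab|abE|ba] := tot a b.
    + by exists b => //; apply: pZD => //; apply: TT ab _.
    + by subst b; exists a => //; apply: pZD.
    + by exists a => //; apply: pZD => //; apply: TT ba _.
move=> a [Ua|[c Pc Ta]] y Ay; first by left; apply: gen_part Ay.
by right; exists c => //; apply: gen_part Ay; right.
Qed.

Lemma part_upto P x : part P x -> x = 0 \/ exists2 c, P c & part (P `&` upto c) x.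
Proof.
move=> Px; have [||/part_set0|[c Pc]] :=
    @part_directed set0 P (fun c => P `&` upto c) x; [| |by left|].
- by move=> c d cd; apply: setIS; apply: upto_mono.
- by apply: partS Px => c Pc; right; exists c => //; split=> //; left.
- by rewrite set0U; right; exists c.
Qed.

(* [A a] only adds to [part T] what [G a] adds to [below a]. *)
Definition hill_closed (T : set S) := forall a x,
  T a -> A a x -> below lt G a x -> part (T `&` under a) x.

Lemma hill_closed_under T b : hill_closed T -> hill_closed (T `&` under b).
Proof.
move=> cT a x [Ta ab] Ax bel; apply: partS (cT a x Ta Ax bel) => c [Tc ca].
by split=> //; split=> //; apply: trans ca ab.
Qed.

Lemma hill_closedU T U : hill_closed T -> hill_closed U -> hill_closed (T `|` U).
Proof.
by move=> cT cU a x [Ta|Ua] Ax bel; [apply: partS (cT a x Ta Ax bel)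
  |apply: partS (cU a x Ua Ax bel)]; apply: setSI; [left|right].
Qed.

Lemma part_reduce T a x : hill_closed T -> part T x ->
  (forall b, T b -> ~ lt b a -> below lt G b x) -> part (T `&` under a) x.
Proof.
move=> cT Tx xbel.
have step b : T b -> part (T `&` upto b) x -> part (T `&` under a) x.
  elim: {b}(wf b) => b _ IH Tb Tbx.
  have [ba|nba] := pselect (lt b a).
    apply: partS Tbx => c [Tc [->|cb]]; split=> //.
    exact: trans cb ba.
  have Tux : part (T `&` under b) x.
    have [y [z [Ty /part_set1 Az xE]]] : exists y z,
        [/\ part (T `&` under b) y, part [set b] z & x = y + z].
      apply: part_union; apply: partS Tbx => c [Tc [->|cb]]; [by right|by left].
    rewrite xE; apply: (is_subD (part_sub _)) => //.
    apply: cT => //; have -> : z = x - y by rewrite xE addrC addKr.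
    apply: (is_subB (bsub _)) => //; first exact: xbel.
    by apply/below_part; apply: partS Ty; apply: subIsetr.
  have [->|[c [Tc cb]]] := part_upto Tux; first exact: part0.
  move=> Tcx; apply: (IH c cb Tc); apply: partS Tcx.
  by apply: setSI; apply: subIsetl.
have [->|[c Tc]] := part_upto Tx; first exact: part0.
exact: step.
Qed.

Lemma factor_part T b : hill_closed T -> hill_closed (b |` T) -> ~ T b ->
  factor C (part T) (part (b |` T)).
Proof.
move=> cT cbT nTb.
have subT : (b |` T) `&` under b `<=` T.
  by move=> c [[->|//] bb]; case: (wf_irrefl wf bb).
have TG x : part T x -> G b x -> below lt G b x.
  move=> Tx Gx; apply/below_part; apply: (@partS (T `&` under b)).
    exact: subIsetr.
  apply: part_reduce => // c Tc ncb; have [//|cb|bc] := tot c b.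
    by exfalso; apply: nTb; rewrite -cb.
  by right; exists b.
have split_bT x : part (b |` T) x -> exists z, A b z /\ part T (x - z).
  move=> /part_union[z [y [/part_set1 Az Ty ->]]]; exists z.
  by rewrite addrC addKr.
have [_ _ _ _ Gfac] := laxG; have [Gb|[N CN [f [flin fsurj fker]]]] := Gfac b.
  left=> x /split_bT[z [Az Tx]]; rewrite -(subrK z x).
  apply: (is_subD (part_sub _)) => //.
  apply: partS subT _; apply: cbT => //; first by left.
  exact/Gb/AG.
right; exists N => //.
have /choice[z zP] x : exists z, part (b |` T) x -> A b z /\ part T (x - z).
  have [/split_bT[z zx]|nx] := pselect (part (b |` T) x); last by exists 0.
  by exists z.
have fN u v : G b u -> G b v -> f (u - v) = f u - f v.
  by move=> Gu Gv; rewrite addrC -scaleN1r flin // scaleN1r addrC.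
have feq u v : A b u -> A b v -> part T (u - v) -> f u = f v.
  move=> /AG Gu /AG Gv Tuv; apply/subr0_eq; rewrite -fN //; apply/fker.
    exact: (is_subB (Gsub b)).
  by apply: TG => //; apply: (is_subB (Gsub b)).
exists (fun x => f (z x)); split=> [a x y bx by_|n|x bx].
- have [Azx Tx] := zP x bx; have [Azy Ty] := zP y by_.
  have [|Az Tz] := zP (a *: x + y); first by have [_] := part_sub (b |` T); apply.
  rewrite -flin; try exact: AG; apply: feq => //; first by have [_] := Asub b; apply.
  have -> : z (a *: x + y) - (a *: z x + z y) =
      (a *: (x - z x) + (y - z y)) - ((a *: x + y) - z (a *: x + y)).
    by rewrite scalerBr addrACA -opprD opprB [RHS]addrC subrKA.
  apply: (is_subB (part_sub _)) => //.
  by have [_] := part_sub T; apply.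
- have [x Gx <-] := fsurj n; have [_ _ _ sup] := supA b; have [y Ay bel] := sup x Gx.
  have bTy : part (b |` T) y by apply: gen_part Ay; left.
  exists y => //; have [Azy Ty] := zP y bTy.
  rewrite (feq (z y) y) //; last by rewrite -opprB; apply: (is_subN (part_sub _)).
  have Gy := AG Ay; apply/esym/subr0_eq; rewrite -fN //.
  by apply/fker => //; apply: (is_subB (Gsub b)).
- have [Azx Tx] := zP x bx; split=> [fz|Tx'].
    rewrite -(subrK (z x) x); apply: (is_subD (part_sub _)) => //.
    apply: partS subT _; apply: cbT => //; first by left.
    by apply/fker => //; apply: AG.
  apply/fker; first exact: AG.
  apply: TG; last exact: AG.
  by rewrite -(subKr x (z x)); apply: (is_subB (part_sub _)).
Qed.

Lemma exists_hill_dependency : exists dep : S -> set S, (forall a, small K (dep a)) /\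
  forall T : set S, (forall a, T a -> dep a `<=` T) -> hill_closed T.
Proof.
have /choice[F FP] : forall ax : S * M, exists F : set S, finite_set F /\
    (below lt G ax.1 ax.2 -> F `<=` under ax.1 /\ part F ax.2).
  move=> [a x] /=; have [/below_part/part_finite[F [Ff Fa Fx]]|nbel] := pselect (below lt G a x).
    by exists F.
  by exists set0.
exists (fun a => \bigcup_(x in A a) F (a, x)); split=> [a|T Tdep a x Ta Ax bel].
  by apply: small_bigcup => // x _; apply: finite_small => //; have [] := FP (a, x).
have [_ /(_ bel)[/= Fa Fx]] := FP (a, x); apply: partS Fx => b Fb; split; last exact: Fa.
by apply: (Tdep a) => //; exists x.
Qed.

Variables (L : Type) (P : L -> lmodType R).
Hypothesis PK : forall l, cardinal_le (P l) K.
Variables (emb : M -> dsum P) (ret : dsum P -> M).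
Hypothesis emb_lin : linear emb.
Hypothesis ret_lin : linear ret.
Hypothesis embK : cancel emb ret.

Definition indices (T : set S) : set L :=
  [set l | exists a x, [/\ T a, A a x & dcoord l (emb x) <> 0]].

(* For suitably closed [T] this is a projection of [M] onto [part T]. *)
Definition proj (T : set S) (x : M) : M := ret (dmask (indices T) (emb x)).

Lemma proj_lin T : linear (proj T).
Proof. by move=> a x y; rewrite /proj emb_lin dmaskP ret_lin. Qed.

Lemma proj_id T x : part T x -> proj T x = x.
Proof.
suff: part T `<=` [set x | proj T x = x] by apply.
apply: part_min => [|a Ta y Ay].
  split=> [|a y z /= yE zE]; last by rewrite proj_lin yE zE.
  by have := proj_lin T (-1) 0 0; rewrite !scaleN1r !addNr.
by rewrite /= /proj dmask_id ?embK // => l yl; exists a, y.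
Qed.

Lemma exists_proj_dependency : exists dep : S -> set S, (forall a, small K (dep a)) /\
  forall T : set S, (forall a, T a -> dep a `<=` T) -> forall x, part T (proj T x).
Proof.
have /choice[F FP] y : exists F : set S, finite_set F /\ part F y.
  by have [F [Ff _ Fy]] := part_finite (part_setT y); exists F.
exists (fun a => \bigcup_(x in A a) \bigcup_(l in [set l | dcoord l (emb x) <> 0])
  \bigcup_(m in [set: P l]) F (ret (dinj m))); split=> [a|T Tdep x].
  apply: small_bigcup => // x _; apply: small_bigcup => // [|l _].
    by apply: finite_small => //; apply: dcoord_finite.
  apply: small_bigcup => // [|m _]; first exact/small_cardinal.
  by apply: finite_small => //; have [] := FP (ret (dinj m)).
suff: (ret @^-1` part T) (dmask (indices T) (emb x)) by [].
apply: (@dsum_ind _ _ _ (indices T)).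
- exact: linear_preimage_sub ret_lin (part_sub T).
- move=> l m [a [y [Ta Ay yl]]]; have [_ Fm] := FP (ret (dinj m)).
  apply: partS Fm => b Fb; apply: (Tdep a Ta); exists y => //; exists l => //.
  by exists m.
- by move=> l; apply: contra_notP => nl; rewrite dcoord_dmask0.
Qed.

Lemma exists_reach : exists rch : S -> set S,
  [/\ forall a, rch a a, forall a, small K (rch a)
    & forall (Q : set S) (T := \bigcup_(a in Q) rch a),
        hill_closed T /\ forall x, part T (proj T x)].
Proof.
have [dep1 [dep1K dep1P]] := exists_hill_dependency.
have [dep2 [dep2K dep2P]] := exists_proj_dependency.
pose r a b := dep1 a b \/ dep2 a b.
exists (reach r); split=> [a|a|Q T]; first exact: reach_refl.
  apply: small_reach => // x; apply: small_sub (_ : small K (\bigcup_(b in [set: bool])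
    (if b then dep1 x else dep2 x))).
    by move=> y [d1|d2]; [exists true|exists false].
  by apply: small_bigcup => // [|[] _] //; apply: finite_small.
have Tr a b : T a -> r a b -> T b.
  by move=> [q Qq qa] ab; exists q => //; apply: reach_step qa ab.
split; first by apply: dep1P => a Ta b ab; apply: Tr Ta _; left.
by apply: dep2P => a Ta b ab; apply: Tr Ta _; right.
Qed.

Variable rch : S -> set S.
Hypothesis rch_refl : forall a, rch a a.
Hypothesis rch_small : forall a, small K (rch a).
Hypothesis rch_closed : forall (Q : set S) (T := \bigcup_(a in Q) rch a),
  hill_closed T /\ forall x, part T (proj T x).

Definition before a := \bigcup_(b in under a) rch b.
Definition through a := \bigcup_(b in upto a) rch b.

Lemma before_through a : before a `<=` through a.
Proof. by move=> c [b ba bc]; exists b => //; right. Qed.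

Lemma through_mono a b : lt a b -> through a `<=` through b.
Proof. by move=> ab c [d /(upto_mono ab) db dc]; exists d. Qed.

Definition piece a : set M := [set x | part (through a) x /\ proj (before a) x = 0].

Lemma proj_sub a : is_sub [set x | proj (before a) x = 0].
Proof.
split=> [|r x y /= xE yE]; first by have := proj_lin (before a) (-1) 0 0; rewrite !scaleN1r !addNr.
by rewrite proj_lin xE yE scaler0 addr0.
Qed.

Lemma piece_sub a : is_sub (piece a).
Proof. exact: is_subI (part_sub _) (proj_sub a). Qed.

Lemma sub_proj_piece a x : part (through a) x -> piece a (x - proj (before a) x).
Proof.
have [_ cp] := rch_closed (under a); have pB := proj_lin (before a).
split; first by apply: (is_subB (part_sub _)) => //; apply: partS (cp x); exact: before_through.
by rewrite addrC -scaleN1r pB scaleN1r proj_id ?addNr.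
Qed.

Lemma piece_small a : small K (piece a).
Proof.
apply: small_sub (_ : small K ((fun x => x - proj (before a) x) @` part (rch a))).
  move=> x [Tx px]; have : part (before a `|` rch a) x.
    apply: partS Tx => c [b [->|ba] bc]; [by right|by left; exists b].
  move=> /part_union[y [z [By Rz xE]]]; exists z => //.
  have zE : z = (-1) *: y + x by rewrite xE scaleN1r addKr.
  have -> : proj (before a) z = - y.
    by rewrite zE proj_lin px addr0 proj_id // scaleN1r.
  by rewrite opprK xE addrC.
apply: small_image; apply: small_hull => //.
by apply: small_bigcup => // b _.
Qed.

Definition piece_module a : lmodType R := submodule (sub_closed (piece_sub a)).

Lemma piece_moduleP a (q : piece_module a) : piece a (submodule_val q).
Proof. exact: (sub_closedE (piece_sub a) _).1 (submodule_valP q). Qed.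

Definition mk_piece a x (ax : piece a x) : piece_module a :=
  @Submodule R M (sub_closed (piece_sub a)) x ((sub_closedE (piece_sub a) x).2 ax).

Lemma piece_module_small a : cardinal_le (piece_module a) K.
Proof.
apply/small_cardinal; apply: (@small_rel_image _ _ _ (fun x (q : piece_module a) => submodule_val q = x)
  _ _ _ _ (piece_small a)) => [x q q' qx q'x|q _].
  by apply: val_inj; rewrite /= qx q'x.
by exists (submodule_val q) => //; apply: piece_moduleP.
Qed.

Lemma piece_module_Filt a : Filt C (piece_module a).
Proof.
pose U b := before a `|` (through a `&` under b).
pose V b := before a `|` (through a `&` upto b).
pose H b : set (piece_module a) := [set q | part (V b) (submodule_val q)].
have before0 (q : piece_module a) : part (before a) (submodule_val q) -> q = 0.
  have [_ qE] := piece_moduleP q; move=> /proj_id.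
  by rewrite qE => /esym q0; apply: val_inj.
have UV b : U b `<=` V b by move=> c [|[ca cb]]; [left|right; split=> //; right].
have Vmono b c : lt b c -> V b `<=` V c.
  by move=> bc; apply: setUS; apply: setIS; apply: upto_mono.
have belowH b q : below lt H b q <-> part (U b) (submodule_val q).
  split=> [[->|[c cb Hc]]|]; first exact: part0.
    apply: partS Hc => d [|[da dc]]; [by left|right; split=> //].
    by case: dc => [->//|dc]; exact: trans dc cb.
  move=> Uq; have [||/before0 ->|[c [ca cb]]] := @part_directed (before a)
      (through a `&` under b) (fun c => through a `&` upto c) (submodule_val q).
  - by move=> c d cd; apply: setIS; apply: upto_mono.
  - apply: partS Uq => c [|[ca cb]]; [by left|right; exists c => //].
    by split=> //; left.
  - by left.
  - by right; exists c.
apply: (@Filt_of_lax _ _ _ S lt H); split.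
- exact: wo.
- move=> b; split=> [|r x y Hx Hy]; first exact: part0.
  by have [_] := part_sub (V b); apply.
- by move=> b c bc q; apply: partS; apply: Vmono.
- move=> q q0; have [||/before0 //|[c ca]] := @part_directed (before a)
      (through a) (fun c => through a `&` upto c) (submodule_val q).
  - by move=> c d cd; apply: setIS; apply: upto_mono.
  - have [Tq _] := piece_moduleP q; apply: partS Tq => c ca.
    by right; exists c => //; split=> //; left.
  - by exists c.
move=> b; have [[nbb tb]|nb] := pselect (~ before a b /\ through a b); last first.
  left=> q Hq; apply/belowH; apply: partS Hq => c [|[ca [cb|cb]]]; [by left| |by right].
  by left; subst c; apply: contrapT => nbb; apply: nb.
have VE : V b = b |` U b.
  apply/seteqP; split=> c.
    by move=> [|[ca [->|cb]]]; [right; left|left|right; right].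
  by move=> [->|/UV//]; right; split=> //; left.
have [cB eB] := rch_closed (under a); have [cT _] := rch_closed (upto a).
have cU : hill_closed (U b) by apply: hill_closedU => //; apply: hill_closed_under.
have cV : hill_closed (b |` U b).
  move=> c x [->|Uc] Ax bel; last first.
    by apply: partS (cU c x Uc Ax bel); apply: setSI; right.
  apply: partS (cT b x tb Ax bel) => d [dT db]; split=> //; right; right; split=> //.
have [|UVs|[N CN [f [flin fsurj fker]]]] := factor_part cU cV.
- by move=> [//|[_ bb]]; exact: wf_irrefl wf bb.
- by left=> q; rewrite /H /= VE => /UVs; apply: (belowH b q).2.
have fN u v : part (b |` U b) u -> part (b |` U b) v -> f (u - v) = f u - f v.
  by move=> Gu Gv; rewrite addrC -scaleN1r flin // scaleN1r addrC.
have bUt : b |` U b `<=` through a.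
  by rewrite -VE => c [/before_through//|[]].
right; exists N => //; exists (fun q => f (submodule_val q)); split.
- by move=> r x y; rewrite /H /= VE => Hx Hy; apply: flin.
- move=> n; have [x Ux fx] := fsurj n.
  have Bx : part (U b) (proj (before a) x) by apply: partS (eB x); left.
  have Vx : part (b |` U b) (proj (before a) x) by apply: partS Bx; right.
  exists (mk_piece (sub_proj_piece (partS bUt Ux))).
    by rewrite /H /= VE; apply: (is_subB (part_sub _)).
  by rewrite /= fN // fx (fker _ Vx).2 // subr0.
- by move=> q; rewrite /H /= VE => Hq; rewrite fker //; split=> /belowH.
Qed.

Lemma piece_decomposition : isomorphic (dsum piece_module) M.
Proof.
pose f a (q : piece_module a) : M := submodule_val q.
have flin a : linear (@f a) by [].
have sum_before a (x : dsum piece_module) : (forall b, dcoord b x <> 0 -> lt b a) ->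
    part (before a) (dlift f x).
  move=> xa; suff: (dlift f @^-1` part (before a)) x by [].
  apply: (@dsum_ind _ _ _ (under a)) => //.
    by apply: linear_preimage_sub (part_sub _); apply: dliftP.
  move=> b q ba; rewrite /preimage /= dlift_inj //.
  have [qT _] := piece_moduleP q; apply: partS qT => c [d [->|db] dc].
    by exists b.
  by exists d => //; apply: trans db ba.
apply: (@isomorphicP _ _ _ (dlift f)); first exact: dliftP.
  move=> x fx0; apply: contrapT => x0; have [a xa amax] := dcoord_max wo x0.
  pose y := (-1) *: dinj (dcoord a x) + x.
  have fy : dlift f y = - f a (dcoord a x).
    by rewrite dliftP // dlift_inj // fx0 addr0 scaleN1r.
  have By : part (before a) (f a (dcoord a x)).
    rewrite -[f _ _]opprK -fy; apply: (is_subN (part_sub _)); apply: sum_before => b.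
    rewrite dcoordP; have [ab|baE|ba] := tot a b.
    - by rewrite (amax b) // dcoord_inj0 ?scaler0 ?addr0 // => abE; move: ab; rewrite abE => /(wf_irrefl wf).
    - by subst b; rewrite dcoord_injE scaleN1r addNr.
    - by [].
  apply: xa; have [_ q0] := piece_moduleP (dcoord a x).
  by apply: val_inj; rewrite /= -[LHS](proj_id By) -[RHS]q0.
have rsub : is_sub (range (dlift f)) by apply: linear_image_sub => //; apply: dliftP.
have rT a : part (through a) `<=` range (dlift f).
  elim: {a}(wf a) => a _ IH x Tx.
  rewrite -(subrK (proj (before a) x) x); apply: (is_subD rsub).
    by exists (dinj (mk_piece (sub_proj_piece Tx))); rewrite ?dlift_inj.
  have [_ /(_ x) Bx] := rch_closed (under a).
  have [||/part_set0 ->|[b ba]] := @part_directed set0 (under a) through (proj (before a) x).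
  - by move=> b c; apply: through_mono.
  - apply: partS Bx => c [b ba bc]; right; exists b => //; exists b => //; by left.
  - exact: is_sub0 rsub.
  - by rewrite set0U; apply: IH.
move=> x; suff [y _ yx] : range (dlift f) x by exists y.
suff: part setT `<=` range (dlift f) by apply; apply: part_setT.
apply: part_min => // a _ y Ay; apply: (rT a); apply: gen_part Ay.
by exists a => //; left.
Qed.

End Hill.

Lemma linear_bijection (R : pzRingType) (M N : lmodType R) : isomorphic M N ->
  exists (f : M -> N) (g : N -> M), [/\ linear f, linear g, cancel f g & cancel g f].
Proof.
move=> [f [g fK gK]]; exists f, g; split=> // a x y; first exact: linearP.
by apply: (can_inj fK); rewrite gK linearP !gK.
Qed.

Lemma infinite_nonzero (R : pzRingType) (M : lmodType R) :
  cardinal_infinite M -> exists m : M, m <> 0.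
Proof.
move=> Minf; apply: contrapT => no; apply: Minf.
apply: (@sub_finite_set _ _ [set (0 : M)]) => // m _.
by apply: contrapT => m0; apply: no; exists m.
Qed.

(** * Categoricity *)

Section Decomposition.
Variables (R : pzRingType) (C : lmodType R -> Prop) (K : Type).
Hypothesis Kinf : cardinal_infinite K.
Hypothesis RK : cardinal_le R K.
Hypothesis CK : forall N, C N -> cardinal_le N K.

(* Kaplansky's theorem on direct summands of direct sums of small modules,
   with the summands obtained so chosen in [Filt C]. *)
Lemma Filt_decomposition (M : lmodType R) L (P : L -> lmodType R)
    (emb : M -> dsum P) (ret : dsum P -> M) :
  (forall l, cardinal_le (P l) K) -> linear emb -> linear ret -> cancel emb ret ->
  Filt C M ->
  exists (S : Type) (Q : S -> lmodType R),
    [/\ forall s, Filt C (Q s), forall s, cardinal_le (Q s) K,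
        forall s, exists q : Q s, q <> 0 & isomorphic M (dsum Q)].
Proof.
move=> PK embl retl embK /lax_of_Filt[S [lt [G laxG]]].
have [A supA] := exists_supplements Kinf RK CK laxG.
have [rch [rch1 rchK rchP]] := exists_reach Kinf laxG supA PK emb retl.
pose Q := piece_module lt A embl retl rch.
exists {a | exists q : Q a, q <> 0}, (fun s => Q (sval s)); split=> [s|s|[a]|].
- exact: (piece_module_Filt laxG supA embl retl embK rchP).
- exact: (piece_module_small Kinf RK supA embl retl embK rchK).
- by [].
- apply: isomorphic_trans (isomorphic_sym (piece_decomposition laxG supA embl retl embK rch1 rchP)) _.
  by apply: dsum_support => a na q; apply: contrapT => q0; apply: na; exists q.
Qed.

Lemma cardinal_option (L : Type) : cardinal_infinite L -> cardinal_le (option L) L.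
Proof.
move=> Linf; apply: cardinal_le_trans (cardinal_seq Linf); apply/cardinal_leP.
by exists (fun o => if o is Some x then [:: x] else [::]) => -[x|] [y|] // [->].
Qed.

Lemma Filt_isomorphic_power (P M : lmodType R) (L : Type) :
  Filt C P -> cardinal_eq P K ->
  (forall N, Filt C N -> cardinal_eq N K -> isomorphic N P) ->
  Filt C M -> cardinal_lt K M -> cardinal_le M L ->
  (forall N N', Filt C N -> Filt C N' -> cardinal_eq N L -> cardinal_eq N' L ->
    isomorphic N N') ->
  isomorphic M (dsum (fun _ : M => P)).
Proof.
move=> FP PK PKuniq FM [KM nKM] ML Luniq.
have KL := cardinal_le_trans KM ML.
have Minf := cardinal_le_infinite KM Kinf; have Linf := cardinal_le_infinite KL Kinf.
have P0 : exists p : P, p <> 0.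
  by apply/infinite_nonzero/(cardinal_le_infinite _ Kinf)/cardinal_eqW/cardinal_eq_sym.
have PL : cardinal_le P L by apply: cardinal_le_trans (cardinal_eqW PK) KL.
have RL := cardinal_le_trans RK KL.
pose X (o : option L) : lmodType R := if o is Some _ then P else M.
have XL : cardinal_eq (dsum X) L.
  apply: cardinal_le_anti.
    apply: cardinal_le_dsum => //; first exact: cardinal_option.
    by case.
  apply: (@cardinal_le_trans (option L)).
    by apply/cardinal_leP; exists Some => x y [].
  by apply: dsum_ge_index => -[l|]; [exact: P0|exact: infinite_nonzero].
have YL : cardinal_eq (dsum (fun _ : L => P)) L.
  apply: cardinal_le_anti; last exact: dsum_ge_index.
  by apply: cardinal_le_dsum => //; exact: cardinal_le_refl.
have [|f [g [flin glin fK gK]]] := @linear_bijection _ (dsum X) (dsum (fun _ : L => P)).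
  by apply: Luniq => //; apply: Filt_dsum => // -[].
have [| | | | |S [Q [FQ QK Q0 isoM]]] := @Filt_decomposition M L (fun _ => P)
    (fun m => f (@dinj _ _ X None m)) (fun y => dcoord None (g y)).
- by move=> _; apply: cardinal_eqW.
- by move=> a x y; rewrite dinjP flin.
- by move=> a x y; rewrite glin dcoordP.
- by move=> m; rewrite fK dcoord_injE.
- by [].
have MQ : cardinal_eq M (dsum Q) := isomorphic_cardinal isoM.
have KS : cardinal_le K S.
  have [//|SK] := cardinal_le_total K S.
  exfalso; apply: nKM; apply: cardinal_le_anti => //.
  by apply: cardinal_le_trans (cardinal_eqW MQ) _; apply: cardinal_le_dsum.
have Sinf := cardinal_le_infinite KS Kinf.
have [k0 _] : exists k : K, True.
  by have [n _] := infinite_sub_injection Kinf; exists (n 0%N).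
have /cardinal_eqP[h hbij] : cardinal_eq (S * K)%type S.
  apply: cardinal_le_anti; last first.
    by apply/cardinal_leP; exists (fun s => (s, k0)) => s t [].
  apply: cardinal_le_trans (cardinal_square Sinf); have /cardinal_leP[i iinj] := KS.
  by apply/cardinal_leP; exists (fun sk => (sk.1, i sk.2)) => -[s k] [t l] [/= -> /iinj ->].
have /cardinal_eqP[e ebij] : cardinal_eq M S.
  apply: cardinal_eq_trans MQ _; apply: cardinal_le_anti; last exact: dsum_ge_index.
  apply: cardinal_le_dsum => //; [exact: cardinal_le_trans KS|exact: cardinal_le_refl|].
  by move=> s; apply: cardinal_le_trans KS.
apply: isomorphic_trans (_ : isomorphic (dsum (fun _ : S => P)) _); last first.
  exact: (@dsum_reindex R S M (fun _ => P) e ebij).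
apply: isomorphic_trans isoM _; apply: isomorphic_trans (dsum_reindex Q hbij) _.
apply: isomorphic_trans (dsum_pair _) _; apply: dsum_isomorphic => s.
apply: PKuniq; first exact: Filt_dsum.
apply: cardinal_le_anti; last exact: dsum_ge_index.
by apply: cardinal_le_dsum => //; exact: cardinal_le_refl.
Qed.

End Decomposition.

Lemma categorical_cardinal_eq (R : pzRingType) (D : lmodType R -> Prop) k l :
  cardinal_eq k l -> categorical k D -> categorical l D.
Proof.
move=> kl [[M DM Mk] uniq]; have lk := cardinal_eq_sym kl; split.
  by exists M => //; apply: cardinal_eq_trans Mk kl.
move=> N N' DN DN' Nl N'l; apply: uniq => //; exact: cardinal_eq_trans lk.
Qed.

Theorem theorem2p12 (R : pzRingType) (D : rmodType R -> Prop) :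
  deconstructible D ->
  (exists theta : cardinal,
     forall lambda : cardinal,
       cardinal_lt theta lambda -> ~ categorical lambda D) \/
  (exists theta' : cardinal,
     forall lambda : cardinal,
       cardinal_le theta' lambda -> categorical lambda D).
Proof.
move=> [k [_ [I [c [_ _ DFilt]]]]].
have [small_cat|large_cat] := pselect (exists theta : cardinal,
    forall lambda : cardinal, cardinal_lt theta lambda -> ~ categorical lambda D).
  by left.
have large (k0 : cardinal) : exists2 l, cardinal_lt k0 l & categorical l D.
  apply: contrapT => no; apply: large_cat; exists k0 => l k0l lcat.
  by apply: no; exists l.
have [K [K0K _] Kcat] := large (nat + (R^c + dsum c))%type.
have RK : cardinal_le R^c K.
  by apply: cardinal_le_trans K0K; apply/cardinal_leP; exists (inr \o inl) => x y [].
have Kinf : cardinal_infinite K.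
  apply: cardinal_le_infinite K0K _; apply/infiniteP/cardinal_leP.
  by exists inl => x y [].
have CK N : range_class c N -> cardinal_le N K.
  move=> [i ->]; apply: cardinal_le_trans K0K; apply/cardinal_leP.
  exists (inr \o (inr \o @dinj _ _ c i)).
  by move=> x y E; apply: (@dinj_injective _ _ c i); apply: inr_inj (inr_inj E).
right; exists K => mu Kmu; have [[P DP PK] Kuniq] := Kcat.
have [/categorical_cardinal_eq|nKmu] := pselect (cardinal_eq K mu); first exact.
have [P0 Kmuinf] : (exists p : P, p <> 0) /\ cardinal_infinite mu.
  split; last exact: cardinal_le_infinite Kmu Kinf.
  by apply/infinite_nonzero/(cardinal_le_infinite _ Kinf)/cardinal_eqW/cardinal_eq_sym.
have power N : D N -> cardinal_eq N mu -> isomorphic N (dsum (fun _ : mu => P)).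
  move=> DN Nmu; have [L [NL _] [_ Luniq]] := large N.
  have [e ebij] : exists e : mu -> N, bijective e.
    by apply/cardinal_eqP/cardinal_eq_sym.
  apply: isomorphic_trans (dsum_reindex (fun _ => P) ebij).
  apply: (Filt_isomorphic_power Kinf RK CK (L := L)) => //.
  - exact/DFilt.
  - by move=> N' /DFilt DN' N'K; apply: Kuniq.
  - exact/DFilt.
  - split; first by apply: cardinal_le_trans Kmu _; apply/cardinal_eqW/cardinal_eq_sym.
    by move=> KN; apply: nKmu; apply: cardinal_eq_trans KN Nmu.
  - by move=> N1 N2 /DFilt D1 /DFilt D2; apply: Luniq.
split.
  exists (dsum (fun _ : mu => P)); first by apply/DFilt/Filt_dsum => _; apply/DFilt.
  apply: cardinal_le_anti; last exact: dsum_ge_index.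
  apply: cardinal_le_dsum => //; [exact: cardinal_le_trans Kmu|exact: cardinal_le_refl|].
  by move=> _; apply: cardinal_le_trans (cardinal_eqW PK) Kmu.
move=> N N' DN DN' Nmu N'mu; apply: isomorphic_trans (power N DN Nmu) _.
exact/isomorphic_sym/power.
Qed.
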